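(* Let $K$ be a number field, let $n>2$ be an integer and let $r$ be a positive integer with $r\mid n$. Then there exists an irreducible polynomial $f\in K[t]$ of degree $n$ with cluster size $r_K(f)=r$.
   Context: Fix an algebraic closure $\bar K$ of $K$. For an irreducible polynomial $f\in K[t]$ and a root $\alpha$ of $f$ in $\bar K$, the cluster size $r_K(f)$ is the number of roots of $f$ (in $\bar K$) that lie in the field $K(\alpha)$; this number does not depend on the choice of the root $\alpha$. *)

(* Defs.v *)
From HB Require Import structures.
From mathcomp Require Import all_boot all_order all_algebra all_field.
Set Implicit Arguments. Unset Strict Implicit. Unset Printing Implicit Defensive.
Import GRing.Theory.
Local Open Scope ring_scope.

(* A number field K is modelled as L : fieldExtType rat (a finite-dimensional
   field extension of Q).  The algebraic closure \bar K is algC, via a field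
   embedding iota : L -> algC (algC is algebraic over Q, hence an algebraic
   closure of iota(L)). *)

Definition in_adjoin (L : fieldExtType rat) (iota : {rmorphism L -> algC})
    (alpha beta : algC) : Prop :=
  forall S : algC -> Prop,
    (forall x : L, S (iota x)) -> S alpha ->
    (forall x y, S x -> S y -> S (x - y)) ->
    (forall x y, S x -> S y -> S (x * y)) ->
    (forall x, S x -> S x^-1) ->
    S beta.

Definition cluster_size (L : fieldExtType rat) (iota : {rmorphism L -> algC})
    (f : {poly L}) (alpha : algC) (r : nat) : Prop :=
  exists s : seq algC, [/\ uniq s, size s = r &
    forall beta, beta \in s <-> (root (map_poly iota f) beta /\ in_adjoin iota alpha beta)].

(* Main.v *)
(* Inside algC, number fields correspond to open subgroups of the group of
   automorphisms [aut] of algC, and every such subgroup is the stabiliser of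
   one element. So it suffices to find an open subgroup [V] of index n in the
   stabiliser [G_K] of K whose coset space G_K / V has exactly r points fixed
   by [V]. Write n = m r.

   If m <> 2, take a normal subgroup [U] of [G_K] of index r (that is, a cyclic
   extension C of K of degree r) and a root [alpha] of an integer polynomial of
   degree m which is irreducible modulo one prime and a product of X and an
   irreducible polynomial modulo another one, both primes having a place of
   degree one in C. Frobenius elements at these places show that the polynomial
   is irreducible over C and that C(alpha) contains only one of its roots; the
   field K(alpha) C does the job.

   If m = 2, take a quadratic extension F of K and a cyclic extension of F of
   degree r which is not Galois over K.

   In both cases the cyclic extension of F comes from Kummer theory over
   F(zeta_r), with descent to F. A place of degree one supplies an algebraic
   integer [gamma] which reduces to a primitive root while all its other
   conjugates reduce to 1; a Frobenius element at that place then generates the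
   cyclic Galois group and acts trivially on the conjugate extensions. *)
Require Import Defs.
From HB Require Import structures.
From mathcomp Require Import all_boot all_order all_algebra all_field.
From mathcomp Require Import cyclic generic_quotient ring_quotient.
From mathcomp Require Import boolp.
From mathcomp Require classical_sets.
Set Implicit Arguments. Unset Strict Implicit. Unset Printing Implicit Defensive.
Import GRing.Theory Num.Theory.
Local Open Scope ring_scope.

Local Notation aut := {rmorphism algC -> algC}.

(** * Open subgroups of the automorphism group of algC *)

Definition autM (s t : aut) : aut := s \o t.
Definition autV (s : aut) : aut := algC_invaut s.

Lemma autVK (s : aut) : cancel s (autV s).
Proof. exact: algC_autK. Qed.

Lemma autKV (s : aut) : cancel (autV s) s.
Proof. exact: algC_invautK. Qed.

Lemma algC_conj_finite (x : algC) :
  {cs : seq algC | forall s : aut, s x \in cs}.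
Proof.
have [cs Dcs] := closed_field_poly_normal (minCpoly x).
exists cs => s; have := root_minCpoly (s x).
by rewrite minCpoly_aut Dcs (monicP (minCpoly_monic x)) scale1r root_prod_XsubC.
Qed.

(** By induction on the polynomial, finite lists of candidates for the coefficients give a finite
    list of candidates for the image. The action is abstract so as to serve both [algC] and the ring
    of algebraic integers. *)
Lemma poly_orbit_finite (R : nzRingType) (G : Type) (act : G -> {rmorphism R -> R}) :
    (forall x, exists cs : seq R, forall g, act g x \in cs) ->
  forall p : {poly R}, exists S : seq {poly R}, forall g, map_poly (act g) p \in S.
Proof.
move=> finR; elim/poly_ind=> [|p c [S IH]].
  by exists [:: 0] => s; rewrite rmorph0 mem_head.
have [cs Hc] := finR c.
exists [seq q * 'X + d%:P | q <- S, d <- cs] => s.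
rewrite rmorphD rmorphM /= map_polyX map_polyC.
by apply/allpairsP; exists (map_poly (act s) p, act s c); split=> /=.
Qed.

Lemma nonroot_exists (R : idomainType) (D : {poly R}) (a : nat -> R) :
  injective a -> D != 0 -> exists t, ~~ root D (a t).
Proof.
move=> inj_a nzD; pose ts := iota 0 (size D).
have [/hasP[t _ rt]|/hasPn allroot] := boolP (has (fun t => ~~ root D (a t)) ts).
  by exists t.
have := @max_poly_roots _ D [seq a t | t <- ts] nzD.
rewrite size_map size_iota ltnn => absurd; suff: false by []; apply: absurd.
  by apply/allP=> _ /mapP[t /allroot rt ->]; rewrite negbK in rt.
by rewrite map_inj_uniq ?iota_uniq.
Qed.

(** The product of the differences of distinct members of [S] is nonzero, so some natural number is
    not a root of it. A natural number is wanted because every automorphism fixes it. *)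
Lemma eval_separates (S : seq {poly algC}) :
  exists t : nat, {in S &, injective (fun p => p.[t%:R])}.
Proof.
pose D := \prod_(pq <- [seq (p, q) | p <- S, q <- S] | pq.1 != pq.2) (pq.1 - pq.2).
have nzD : D != 0.
  rewrite prodf_seq_neq0; apply/allP => -[p q] _; rewrite subr_eq0; exact/implyP.
have inj_nat : injective (fun t : nat => t%:R : algC).
  by apply: mulrIn; rewrite oner_eq0.
have [t rt] := nonroot_exists inj_nat nzD; exists t => p q Sp Sq eq_pq.
apply: contraNeq rt => ne_pq; rewrite /D (big_rem (p, q)) /= ?ne_pq.
  by rewrite rootM /root hornerD hornerN eq_pq subrr eqxx.
by apply/allpairsP; exists (p, q).
Qed.

(** Evaluation at a natural number that separates the finite orbit of [p] commutes with
    automorphisms and loses nothing: a primitive element obtained by specialisation. *)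
Lemma poly_stab (p : {poly algC}) :
  exists x : algC, forall s : aut, s x = x <-> map_poly s p = p.
Proof.
have finC x : exists cs : seq algC, forall s : aut, s x \in cs.
  by have [cs] := algC_conj_finite x; exists cs.
have [S HS] := poly_orbit_finite finC p; have [t inj_t] := eval_separates S.
exists p.[t%:R] => s.
have -> : s p.[t%:R] = (map_poly s p).[t%:R] by rewrite -horner_map rmorph_nat.
split=> [|-> //]; apply: inj_t => //.
by have := HS idfun; rewrite map_poly_id.
Qed.

Definition stab (xs : seq algC) (s : aut) : Prop := forall x, x \in xs -> s x = x.

(** Openness is that of the Krull topology; [os_ext] makes membership depend only on the values of
    an automorphism. *)
Record open_subgroup (U : aut -> Prop) : Prop := OpenSubgroup {
  os_ext : forall s t : aut, s =1 t -> U s -> U t;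
  osM : forall s t, U s -> U t -> U (autM s t);
  osV : forall s, U s -> U (autV s);
  os_open : exists xs, forall s, stab xs s -> U s }.

Lemma os_id U : open_subgroup U -> U idfun.
Proof. by move=> oU; have [xs] := os_open oU; apply. Qed.

Lemma stab_open xs : open_subgroup (stab xs).
Proof.
split=> [s t eq_st sx x|s t sx tx x|s sx x|]; last by exists xs.
- by move=> xsx; rewrite -eq_st sx.
- by move=> xsx /=; rewrite tx ?sx.
- by move=> xsx; rewrite -{1}(sx x xsx) autVK.
Qed.

Lemma stab1P x (s : aut) : stab [:: x] s <-> s x = x.
Proof. by split=> [->|sx y]; rewrite ?mem_head // inE => /eqP->. Qed.

Lemma open_subgroupI U V :
  open_subgroup U -> open_subgroup V -> open_subgroup (fun s => U s /\ V s).
Proof.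
move=> oU oV; split.
- by move=> s t e [/(os_ext oU e) Ut /(os_ext oV e)].
- by move=> s t [? ?] [? ?]; split; [exact: (osM oU)|exact: (osM oV)].
- by move=> s [? ?]; split; [exact: (osV oU)|exact: (osV oV)].
have [[xs Hx] [ys Hy]] := (os_open oU, os_open oV); exists (xs ++ ys) => s sxy.
split; [apply: Hx => x xsx|apply: Hy => x ysx].
  by rewrite sxy // mem_cat xsx.
by rewrite sxy // mem_cat ysx orbT.
Qed.

(* If the stabiliser of [z] lies in [U], then [U] is exactly the stabiliser of
   the polynomial whose roots are the [U]-orbit of [z], hence of a generic
   value of that polynomial. *)
Lemma open_subgroup_stab U :
  open_subgroup U -> exists x : algC, forall s : aut, U s <-> s x = x.
Proof.
move=> oU; have [ys Hys] := os_open oU.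
have [z Hz] := poly_stab (\poly_(i < size ys) ys`_i).
have Uz (s : aut) : s z = z -> U s.
  move/Hz=> /polyP sys; apply: Hys => y /(nthP 0)[i lti <-].
  by have := sys i; rewrite coef_map coef_poly lti.
have [cs Hcs] := algC_conj_finite z.
pose orb := undup [seq y <- cs | `[< exists2 u : aut, U u & y = u z >]].
have orbP y : reflect (exists2 u : aut, U u & y = u z) (y \in orb).
  rewrite mem_undup mem_filter; apply: (iffP andP) => [[/asboolP exu _] //|[u Uu ->]].
  by split; [apply/asboolP; exists u|exact: Hcs].
have [x Hx] := poly_stab (\prod_(y <- orb) ('X - y%:P)).
exists x => s; rewrite Hx rmorph_prod /=.
under eq_bigr => y _ do rewrite map_polyXsubC.
rewrite -(big_map s predT (fun y => 'X - y%:P)); split=> [Us|eqP].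
  apply: perm_big; apply: uniq_perm; rewrite ?undup_uniq //.
    by rewrite map_inj_uniq ?undup_uniq //; apply: fmorph_inj.
  move=> y; apply/mapP/orbP => [[_ /orbP[u Uu ->] ->]|[u Uu ->]].
    by exists (autM s u); first exact: (osM oU).
  exists (autM (autV s) u z); last by rewrite /= autKV.
  by apply/orbP; exists (autM (autV s) u) => //; apply: (osM oU) Uu; exact: (osV oU).
have : s z \in orb.
  rewrite -root_prod_XsubC -eqP root_prod_XsubC map_f //.
  by apply/orbP; exists idfun => //; apply: os_id.
case/orbP=> u Uu suz; have Uus: U (autM (autV u) s).
  by apply: Uz; rewrite /= suz autVK.
apply: (os_ext oU) (osM oU Uu Uus) => y.
by rewrite /= autKV.
Qed.

Lemma perm_map_stable (T : eqType) (f : T -> T) (s : seq T) :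
  injective f -> uniq s -> {subset [seq f x | x <- s] <= s} ->
  perm_eq [seq f x | x <- s] s.
Proof.
move=> inj_f Us sub; have Ufs : uniq [seq f x | x <- s] by rewrite map_inj_uniq.
apply: uniq_perm => //; apply: (uniq_min_size Ufs sub _).2.
by rewrite size_map.
Qed.

(** Take the splitting field of the product of the minimal polynomials; being normal over the
    rationals, it is open to finite Galois theory. *)
Lemma normal_num_field_exists (xs : seq algC) :
  exists (Qn : splittingFieldType rat) (QnC : {rmorphism Qn -> algC}),
    forall x, x \in xs -> exists y, QnC y = x.
Proof.
have [p mon_p rp]: exists2 p : {poly rat}, p \is monic
    & forall x, x \in xs -> root (map_poly ratr p) x.
  elim: xs => [|x xs [p mon_p rp]]; first by exists 1; rewrite ?monic1.
  have [q [Dq mon_q] _] := minCpolyP x.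
  exists (q * p); first exact: rpredM.
  move=> y; rewrite rmorphM /= rootM -Dq inE => /predU1P[->|/rp->].
    by rewrite root_minCpoly.
  by rewrite orbT.
have [rs Drs] := closed_field_poly_normal (map_poly ratr p : {poly algC}).
rewrite lead_coef_map (monicP mon_p) rmorph1 scale1r in Drs.
have [Q [QC [rr Drr genQ]]] := num_field_exists rs.
have splitQ : splitting_field_axiom Q.
  exists (map_poly (in_alg Q) p).
    by apply/polyOverP => i; rewrite coef_map memvZ ?memv_line.
  exists rr => //; apply/eqpP; exists (1, 1); rewrite ?oner_neq0 // !scale1r.
  apply: (map_poly_inj QC); rewrite -map_poly_comp.
  rewrite (eq_map_poly (g := ratr)) => [|a]; last by rewrite /= rmorphZ_num rmorph1 mulr1.
  rewrite Drs -Drr big_map rmorph_prod /=; apply: eq_bigr => y _.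
  by rewrite map_polyXsubC.
pose Qn : splittingFieldType rat :=
  HB.pack (FieldExt.sort Q) (FieldExt_isSplittingField.Build rat Q splitQ).
exists Qn, QC => x /rp; rewrite Drs root_prod_XsubC -Drr => /mapP[y _ ->].
by exists y.
Qed.

(** * Subfields of [algC] as predicates, and Galois descent *)

Section FieldPredicate.
Variable S : algC -> Prop.
Hypotheses (S1 : S 1) (SB : forall x y, S x -> S y -> S (x - y))
  (SM : forall x y, S x -> S y -> S (x * y)) (SV : forall x, S x -> S x^-1).

Lemma field_pred0 : S 0. Proof. by rewrite -(subrr 1); apply: SB. Qed.

Lemma field_predD x y : S x -> S y -> S (x + y).
Proof.
by move=> Sx Sy; rewrite -[y]opprK -[- y]sub0r; apply/SB/SB/Sy/field_pred0.
Qed.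

Lemma field_pred_rat (a : rat) : S (ratr a).
Proof.
have SN (n : nat) : S n%:R.
  elim: n => [|n IH]; first exact: field_pred0.
  by rewrite -addn1 natrD; apply: field_predD.
have SZ (m : int) : S m%:~R.
  case: m => n; first exact: SN.
  by rewrite NegzE rmorphN -sub0r; apply/SB/SN/field_pred0.
by rewrite /ratr; apply/SM/SV/SZ/SZ.
Qed.

Lemma field_pred_adjoin (Q : fieldExtType rat) (QC : {rmorphism Q -> algC}) rs :
  (forall y, y \in rs -> S (QC y)) -> forall y, y \in <<1 & rs>>%VS -> S (QC y).
Proof.
elim/last_ind: rs => [|rs x IH] Srs y.
  rewrite Fadjoin_nil => /vlineP[a ->]; rewrite rmorphZ_num rmorph1 mulr1.
  exact: field_pred_rat.
rewrite adjoin_rcons => /Fadjoin_polyP[p Kp ->].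
have Sp i : S (QC p`_i).
  apply: IH; last exact: (polyOverP Kp).
  by move=> z rsz; apply: Srs; rewrite mem_rcons inE rsz orbT.
rewrite horner_coef rmorph_sum; apply: (big_ind S field_pred0 field_predD) => i _.
rewrite rmorphM rmorphXn; apply: SM => //.
elim: (i : nat) => [|j Sj]; first by rewrite expr0.
rewrite exprS; apply: SM => //.
by apply: Srs; rewrite mem_rcons mem_head.
Qed.

(** In a finite normal extension containing [z] and [xs], each Galois automorphism over the field
    generated by [xs] extends to [algC], hence fixes [z]; so [z] lies in that field, and therefore
    in [S]. *)
Lemma fixed_field_pred (xs : seq algC) z :
    (forall x, x \in xs -> S x) -> (forall s : aut, stab xs s -> s z = z) ->
  S z.
Proof.
move=> Sxs fixz; have [Q [QC HQ]] := normal_num_field_exists (z :: xs).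
have [y Dy] := HQ z (mem_head _ _).
have [ys Dys]: exists ys, map QC ys = xs.
  have {}HQ x : x \in xs -> exists y, QC y = x.
    by move=> xsx; apply: HQ; rewrite inE xsx orbT.
  elim: xs HQ {Sxs fixz} => [|x xs IH] HQ; first by exists [::].
  have [|ys Dys] := IH; first by move=> u xsu; apply: HQ; rewrite inE xsu orbT.
  by have [u Du] := HQ x (mem_head _ _); exists (u :: ys); rewrite /= Du Dys.
rewrite -Dy; apply: (field_pred_adjoin (rs := ys)).
  by move=> u ysu; apply: Sxs; rewrite -Dys map_f.
have galQ : galois <<1 & ys>>%AS {:Q}.
  rewrite /galois subvf normalFieldf andbT; apply/separableP => u _.
  by apply: pcharf0_separable => i; rewrite pchar_lalg pchar_num.
rewrite -[<<1 & ys>>%VS](elimT galois_fixedField galQ).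
apply/fixedFieldP; rewrite ?memvf // => g.
rewrite gal_kHom ?subvf // => /kHomP_tmp[fixg _].
have [s Ds] := extend_algC_subfield_aut QC g.
apply: (fmorph_inj QC); rewrite Ds Dy; apply: fixz => x; rewrite -Dys.
case/mapP=> u ysu ->; rewrite -Ds; congr (QC _); apply: fixg.
exact: seqv_sub_adjoin.
Qed.
End FieldPredicate.

(** * Places of the ring of algebraic integers *)

Section ResidueField.
Import classical_sets.
Local Open Scope quotient_scope.
Variables (R : comNzRingType) (a : R).
Hypothesis a_nonunit : forall b, b * a != 1.

Let is_ideal (J : set R) :=
  [/\ J a, ~ J 1 & forall c u v, J u -> J v -> J (c * u + v)].

Lemma maximal_ideal_exists :
  exists J : set R, is_ideal J /\ forall x, ~ J x -> exists c, J (c * x - 1).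
Proof.
(* The guard [J x] admits the empty set, as the union of the empty chain requires; comparison with
   the principal ideal of [a] then shows that the maximal element is not empty. *)
have [F subF totF|A [PA maxA]] := @Zorn_bigcup R (fun J => forall x, J x -> is_ideal J).
  move=> z [X FX Xz]; have idF Y y : F Y -> Y y -> is_ideal Y by move=> /subF; apply.
  have [Xa nX1 _] := idF _ _ FX Xz; split=> [|[Y FY Y1]|c u v [Y FY Yu] [Z FZ Zv]].
  - by exists X.
  - by have [] := idF _ _ FY Y1.
  have [sub|sub] := totF _ _ FY FZ.
    by exists Z => //; have [_ _] := idF _ _ FZ Zv; apply=> //; apply: sub.
  by exists Y => //; have [_ _] := idF _ _ FY Yu; apply=> //; apply: sub.
have [x Ax]: exists x, A x.
  apply: contrapT => /forallNP nA.
  have ida : is_ideal (fun x => exists b, x = b * a).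
    split=> [|[b]|c _ _ [b ->] [d ->]]; first by exists 1; rewrite mul1r.
      by move/esym/eqP; rewrite (negPf (a_nonunit b)).
    by exists (c * b + d); rewrite mulrDl mulrA.
  have [] := maxA (fun x => exists b, x = b * a); last by [].
  split=> [x Ax|sub]; first by case: (nA x).
  by apply: (nA a); apply: sub; exists 1; rewrite mul1r.
have idA := PA _ Ax; exists A; split=> // y nAy; have [Aa nA1 AD] := idA.
have A0 : A 0 by rewrite -(addNr a) -mulN1r; apply: AD.
pose B : set R := fun z => exists c, exists2 i, A i & z = c * y + i.
have subAB : (A `<=` B)%classic by move=> i Ai; exists 0; exists i; rewrite ?mul0r ?add0r.
have By : B y by exists 1; exists 0; rewrite ?mul1r ?addr0.
have B1 : B 1.
  apply: contrapT => nB1; apply: (maxA B); first by split=> // sub; apply/nAy/sub.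
  move=> _ _; split=> //; first exact: subAB.
  move=> c _ _ [d [i Ai ->]] [e [j Aj ->]].
  exists (c * d + e); exists (c * i + j); first exact: AD.
  by rewrite mulrDl mulrDr mulrA addrACA.
have [c [i Ai e1]] := B1; exists c; rewrite e1 opprD addrA subrr add0r.
by rewrite -mulN1r -[_ * _]addr0; apply: AD.
Qed.

(** Quotient by a maximal ideal containing [a]. With [a] a prime number this is a place above that
    prime. *)
Lemma residue_field_exists :
  exists (k : fieldType) (Phi : {rmorphism R -> k}), Phi a = 0.
Proof.
have [J [[Ja nJ1 JD] invJ]] := maximal_ideal_exists.
have J0 : J 0 by rewrite -(addNr a) -mulN1r; apply: JD.
pose P : {pred R} := fun x => `[< J x >].
have idP : idealr_closed P.
  split; first exact/asboolP.
    by apply/negP => /asboolP.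
  by move=> c u v /asboolP Ju /asboolP Jv; apply/asboolP/JD.
pose I : idealr R := HB.pack P (isIdealr.Build R P idP).
pose Q := {ideal_quot I}.
have piE0 (x : R) : (\pi_Q x == 0 :> Q) = `[< J x >].
  by rewrite -[0 :> Q](rmorph0 \pi_Q); have := Quotient.idealrBE I x 0; rewrite subr0 => <-.
have inv_ex (x : Q) : exists y : Q, if x == 0 then y = 0 else y * x = 1.
  have [_|x0] := eqVneq x 0; first by exists 0.
  have [|c /asboolP] := invJ (repr x).
    by move/asboolP; rewrite -piE0 reprK; apply/negP.
  rewrite -piE0 rmorphB rmorph1 subr_eq0 rmorphM /= reprK => /eqP e.
  by exists (\pi_Q c).
pose inv x := projT1 (cid (inv_ex x)).
have invP x : if x == 0 then inv x = 0 else inv x * x = 1 by rewrite /inv; case: cid.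
have mulVf x : x != 0 -> inv x * x = 1 by move/negPf=> x0; have := invP x; rewrite x0.
have inv0 : inv 0 = 0 by have := invP 0; rewrite eqxx.
pose k : fieldType := HB.pack Q (GRing.ComNzRing_isField.Build Q mulVf inv0).
exists k, (\pi_Q : {rmorphism R -> k}).
by apply/eqP; rewrite piE0; apply/asboolP.
Qed.
End ResidueField.

(** All algebraic integers are packed in one ring, so that a place is a plain ring morphism to a
    field. *)
Definition Zbar := {x : algC | x \in Aint}.
HB.instance Definition _ := SubChoice.on Zbar.
HB.instance Definition _ := [SubChoice_isSubComNzRing of Zbar by <:].

Definition autZ (s : aut) (x : Zbar) : Zbar :=
  Sub (s (val x)) (etrans (Aint_aut s (val x)) (valP x)).

Lemma val_autZ s x : val (autZ s x) = s (val x).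
Proof. by rewrite SubK. Qed.

Fact autZ_is_zmod_morphism s : zmod_morphism (autZ s).
Proof. by move=> x y; apply: val_inj; rewrite !(val_autZ, rmorphB). Qed.

Fact autZ_is_monoid_morphism s : monoid_morphism (autZ s).
Proof.
by split=> [|x y]; apply: val_inj; rewrite !(val_autZ, rmorphM, rmorph1).
Qed.

HB.instance Definition _ s :=
  GRing.isZmodMorphism.Build Zbar Zbar (autZ s) (autZ_is_zmod_morphism s).
HB.instance Definition _ s :=
  GRing.isMonoidMorphism.Build Zbar Zbar (autZ s) (autZ_is_monoid_morphism s).

Lemma autZ_inj s : injective (autZ s).
Proof.
by move=> x y /(congr1 val); rewrite !val_autZ => /fmorph_inj/val_inj.
Qed.

(** Galois descent makes [x] rational, and a rational algebraic integer is an integer. *)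
Lemma Zbar_fixed_int (x : Zbar) : (forall s, autZ s x = x) -> exists m : int, x = m%:~R.
Proof.
move=> fixx; have Qx : val x \in Crat.
  apply: (@fixed_field_pred (fun z => z \in Crat) _ _ _ _ [::]) => //.
  - by move=> y z; apply: rpredB.
  - by move=> y z; apply: rpredM.
  - by move=> y; rewrite rpredV.
  - by move=> s _; rewrite -val_autZ fixx.
have /intrP[m Dm] := Cint_rat_Aint Qx (valP x); exists m.
by apply: val_inj; rewrite Dm rmorph_int.
Qed.

Lemma Zbar_orbit_finite (x : Zbar) : exists cs : seq Zbar, forall s, autZ s x \in cs.
Proof.
have [cs Hcs] := algC_conj_finite (val x); exists [seq insubd 0 c | c <- cs] => s.
apply/mapP; exists (s (val x)) => //; apply: val_inj.
by rewrite insubdK ?val_autZ // unfold_in Aint_aut (valP x).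
Qed.

(* The conjugates [p'] of [p = sum xs_i T^i] are the roots of a polynomial [R]
   with coefficients in Z[T], so Frobenius, applied to the coefficients of the
   reduction of [p], sends it to the reduction of some [p']. *)
Lemma frobenius_lift (q : nat) (k : fieldType) (Phi : {rmorphism Zbar -> k}) :
    q \in [pchar k] ->
  forall xs : seq Zbar,
  exists s : aut, forall x, x \in xs -> Phi (autZ s x) = Phi x ^+ q.
Proof.
move=> qk xs; pose p := \poly_(i < size xs) xs`_i.
have [S HS] := poly_orbit_finite Zbar_orbit_finite p.
pose orb := undup [seq p' <- S | `[< exists s : aut, p' = map_poly (autZ s) p >]].
have orbP p' : reflect (exists s : aut, p' = map_poly (autZ s) p) (p' \in orb).
  rewrite mem_undup mem_filter; apply: (iffP andP) => [[/asboolP//]|[s ->]].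
  by split; [apply/asboolP; exists s|exact: HS].
pose R : {poly {poly Zbar}} := \prod_(p' <- orb) ('X - p'%:P).
have fixR s : map_poly (map_poly (autZ s)) R = R.
  rewrite rmorph_prod /=; under eq_bigr => p' _ do rewrite map_polyXsubC.
  rewrite -(big_map (map_poly (autZ s)) predT (fun p' => 'X - p'%:P)).
  apply: perm_big; apply: perm_map_stable (undup_uniq _) _.
    by apply: map_inj_poly; [apply: autZ_inj|apply: rmorph0].
  move=> _ /mapP[_ /orbP[t ->] ->]; apply/orbP; exists (autM s t).
  by apply/polyP=> i; apply: val_inj; rewrite !coef_map !val_autZ.
have intR i j : exists m : int, R`_i`_j = m%:~R.
  by apply: Zbar_fixed_int => s; rewrite -{2}(fixR s) !coef_map.
pose F := pFrobenius_aut qk.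
pose rR := map_poly (map_poly Phi) R.
have FR : map_poly (map_poly F) rR = rR.
  apply/polyP=> i; apply/polyP=> j; rewrite !coef_map /=.
  by have [m ->] := intR i j; rewrite !rmorph_int.
have orb_p : p \in orb.
  apply/orbP; exists idfun; apply/polyP=> i; rewrite coef_map.
  by apply: val_inj; rewrite val_autZ.
have Rp0 : R.[p] = 0.
  by rewrite horner_prod (big_rem p) //= hornerXsubC subrr mul0r.
have: root rR (map_poly Phi p) by apply/rootP; rewrite horner_map Rp0 rmorph0.
move/rootP/(congr1 (map_poly F)); rewrite rmorph0 -horner_map FR.
rewrite /rR /R rmorph_prod horner_prod => /eqP.
rewrite prodf_seq_eq0 => /hasP[_ /orbP[s ->] /=].
rewrite !map_polyXsubC hornerXsubC subr_eq0 => /eqP/polyP e.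
exists s => x /(nthP 0)[i lti <-].
have := e i; rewrite !coef_map coef_poly lti /= => <-.
exact: pFrobenius_autE.
Qed.

(* Euclid's argument: [g (c M t) = c w] with [c = g 0] and [w = 1 mod M]. *)
Lemma poly_prime_divisor (g : {poly int}) (M : nat) :
    (1 < size g)%N -> (0 < M)%N ->
  exists q u, [/\ prime q, ~~ (q %| M)%N & (q%:Z %| g.[u])%Z].
Proof.
elim/poly_ind: g => [|h c _ sz_g M_gt0]; first by rewrite size_poly0.
have [c0|nzc] := eqVneq c 0.
  have [q ltMq pr_q] := prime_above M; exists q, q%:Z; split=> //.
    by apply: contraL ltMq => /(dvdn_leq M_gt0); rewrite -leqNgt.
  by rewrite c0 addr0 hornerMX dvdz_mull.
set g := h * 'X + c%:P in sz_g *.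
(* A non-root of [D] makes [w] differ from 0, 1 and -1, so that [w] has a prime divisor. *)
pose D := g * ((g - c%:P) * (g + c%:P)).
have sz_c (d : int) : (size (d%:P : {poly int}) < size g)%N.
  exact: leq_ltn_trans (size_polyC_leq1 d) sz_g.
have nz_gc (d : int) : g + d%:P != 0.
  by rewrite -size_poly_gt0 size_polyDl // (ltn_trans _ sz_g).
have nzD : D != 0.
  by rewrite !mulf_neq0 // -?polyCN ?nz_gc //; have := nz_gc 0; rewrite addr0.
have inj_a : injective (fun t : nat => c * M%:Z * t%:Z).
  have nz_cM : c * M%:Z != 0 by rewrite mulf_neq0 //; case: (M) M_gt0.
  by move=> t1 t2 /(mulfI nz_cM) [].
have [t] := nonroot_exists inj_a nzD; set u := c * M%:Z * t%:Z.
have [w Dw]: exists w, w = 1 + M%:Z * (t%:Z * h.[u]) by exists (1 + M%:Z * (t%:Z * h.[u])).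
have gu : g.[u] = c * w.
  by rewrite /g hornerMXaddC Dw mulrDr mulr1 addrC; congr (_ + _); rewrite mulrC !mulrA.
have Du (g0 : {poly int}) : (g0 * ((g0 - c%:P) * (g0 + c%:P))).[u]
    = g0.[u] * ((g0.[u] - c) * (g0.[u] + c)) by rewrite !hornerE.
have cwB : c * w - c = c * (w - 1) by rewrite mulrBr mulr1.
have cwD : c * w + c = c * (w + 1) by rewrite mulrDr mulr1.
rewrite /root {}Du gu cwB cwD !mulf_eq0 (negPf nzc) /= !negb_or subr_eq0 addr_eq0.
case/and3P=> w0 w1 wN1.
have w_gt1 : (1 < `|w|)%N.
  rewrite ltn_neqAle absz_gt0 w0 andbT eq_sym.
  apply: contra_neqN w1 => /eqP; case: (w) wN1 => -[|[|m]] //.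
exists (pdiv `|w|), u; split; first exact: pdiv_prime.
  apply/negP=> qM; have : (pdiv `|w| %| 1%N)%N.
    suff: ((pdiv `|w|)%:Z %| 1%:Z)%Z by rewrite dvdzE.
    have -> : 1%:Z = w - M%:Z * (t%:Z * h.[u]) by rewrite Dw addrK.
    by rewrite rpredB ?dvdz_mulr // dvdzE //= pdiv_dvd.
  by rewrite dvdn1 => /eqP p1; have := pdiv_prime w_gt1; rewrite p1.
by rewrite gu dvdz_mull // dvdzE /= pdiv_dvd.
Qed.

Lemma Zbar_orbit (theta : Zbar) :
  exists orb : seq Zbar, [/\ uniq orb, theta \in orb,
    forall y, y \in orb -> exists s : aut, y = autZ s theta &
    forall s : aut, perm_eq [seq autZ s y | y <- orb] orb].
Proof.
have [cs Hcs] := Zbar_orbit_finite theta.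
pose orb := undup [seq y <- cs | `[< exists s : aut, y = autZ s theta >]].
have orbP y : reflect (exists s : aut, y = autZ s theta) (y \in orb).
  rewrite mem_undup mem_filter; apply: (iffP andP) => [[/asboolP//]|[s ->]].
  by split; [apply/asboolP; exists s|exact: Hcs].
have Uorb : uniq orb := undup_uniq _.
exists orb; split=> // [|y /orbP //|s].
  by apply/orbP; exists idfun; apply: val_inj; rewrite val_autZ.
apply: perm_map_stable Uorb _; first exact: autZ_inj.
move=> _ /mapP[_ /orbP[t ->] ->]; apply/orbP; exists (autM s t).
by apply: val_inj; rewrite !val_autZ.
Qed.

Lemma Zbar_orbit_poly (orb : seq Zbar) :
    (forall s : aut, perm_eq [seq autZ s y | y <- orb] orb) ->
  exists g : {poly int}, map_poly intr g = \prod_(y <- orb) ('X - y%:P).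
Proof.
move=> perm_orb; set P := \prod_(y <- orb) _.
have fixP s : map_poly (autZ s) P = P.
  rewrite rmorph_prod /=; under eq_bigr => y _ do rewrite map_polyXsubC.
  by rewrite -(big_map (autZ s) predT (fun y => 'X - y%:P)); apply: perm_big.
have intP i : exists m : int, P`_i = m%:~R.
  by apply: Zbar_fixed_int => s; rewrite -{2}(fixP s) coef_map.
pose c i := projT1 (cid (intP i)); exists (\poly_(i < size P) c i).
apply/polyP=> i; rewrite coef_map coef_poly /c; case: cid => m /= Dm.
by case: ltnP => // leP; rewrite nth_default ?rmorph0.
Qed.

Lemma intr_eq0_pchar (k : fieldType) (q : nat) (m : int) :
  q \in [pchar k] -> (m%:~R == 0 :> k) = (q %| `|m|)%N.
Proof.
move=> qk; rewrite (dvdn_pcharf qk); case: m => n //=.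
by rewrite NegzE rmorphN oppr_eq0.
Qed.

Lemma Zbar_intr_inj : injective (intr : int -> Zbar).
Proof.
by move=> m n /(congr1 val); rewrite !rmorph_int; apply: intr_inj.
Qed.

Lemma prime_nonunit_Zbar (q : nat) (b : Zbar) : prime q -> b * q%:R != 1.
Proof.
move=> pr_q; apply/eqP => /(congr1 val); rewrite rmorphM rmorph_nat rmorph1 => bq1.
have q0 : (q%:R : algC) != 0 by rewrite pnatr_eq0 -lt0n prime_gt0.
have bE : val b = q%:R^-1 by rewrite -[LHS](mulfK q0) bq1 mul1r.
have : val b \in Num.int.
  by apply: Cint_rat_Aint (valP b); rewrite bE rpredV rpred_nat.
move/intrP=> [m Dm]; have: (m * q%:Z)%:~R = 1%:~R :> algC.
  by rewrite intrM -Dm bE mulVf.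
move/intr_inj/(congr1 absz); rewrite abszM /= => /eqP.
by rewrite muln_eq1 => /andP[_ /eqP q1]; rewrite q1 in pr_q.
Qed.

(** Arbitrarily large places of degree one of the field of [theta], without any density theorem. The
    prime [q] divides a value at an integer [u] of the polynomial [g] of the conjugates of [theta],
    but not the discriminant. So [theta] may be assumed to reduce to [u], and a lift of Frobenius
    fixes [theta] because distinct conjugates have distinct reductions. *)
Lemma place_exists (theta : Zbar) (B : nat) :
  exists (q : nat) (k : fieldType) (Phi : {rmorphism Zbar -> k}),
  [/\ prime q, (B < q)%N, q \in [pchar k],
      forall xs : seq Zbar, exists s : aut,
        autZ s theta = theta /\ forall x, x \in xs -> Phi (autZ s x) = Phi x ^+ q &
      exists H : Zbar, [/\ Phi H != 0,
        forall s, autZ s theta = theta -> autZ s H = H &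
        forall s, autZ s theta <> theta -> Phi (autZ s H) = 0]].
Proof.
have [orb [Uorb orb_theta orbP perm_orb]] := Zbar_orbit theta.
have [g Dg] := Zbar_orbit_poly perm_orb.
(* The product [d] of the [E y] is the discriminant of [g] up to sign. *)
pose E (y : Zbar) := \prod_(z <- orb | z != y) (y - z).
have [d Dd]: exists d : int, \prod_(y <- orb) E y = d%:~R.
  apply: Zbar_fixed_int => s; rewrite rmorph_prod -[RHS](perm_big _ (perm_orb s)) big_map.
  apply: eq_bigr => y _; rewrite /E rmorph_prod -[RHS](perm_big _ (perm_orb s)) big_map.
  by apply: eq_big => [z|z _]; rewrite ?(inj_eq (@autZ_inj s)) ?rmorphB.
have nz_d : d != 0.
  apply: contraNneq (oner_neq0 algC) => d0; move/(congr1 val): Dd.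
  rewrite d0 rmorph0 rmorph_prod => /eqP; rewrite prodf_seq_eq0 => /hasP[y _ /andP[_]].
  rewrite /E rmorph_prod prodf_seq_eq0 => /hasP[z _ /andP[ne_zy]].
  by rewrite rmorphB subr_eq0 => /eqP/val_inj e; rewrite e eqxx in ne_zy.
have sz_g : (1 < size g)%N.
  rewrite -(size_map_inj_poly Zbar_intr_inj (rmorph0 _)) Dg size_prod_XsubC ltnS.
  by case: (orb) orb_theta.
(* A prime not dividing this modulus is prime to [d] and, thanks to the factorial, exceeds [B]. *)
have M_gt0 : (0 < `|d| * B`!)%N by rewrite muln_gt0 fact_gt0 absz_gt0 nz_d.
have [q [u [pr_q qM q_gu]]] := poly_prime_divisor sz_g M_gt0.
have [qd qB]: ~~ (q %| `|d|)%N /\ (B < q)%N.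
  split; first by apply: contra qM => qd; apply: dvdn_mulr.
  by rewrite ltnNge; apply: contra qM => leqB; rewrite dvdn_mull ?dvdn_fact ?prime_gt0.
have [k [Phi0 Phi0q]] := residue_field_exists (fun b => prime_nonunit_Zbar b pr_q).
have qk : q \in [pchar k] by rewrite inE pr_q /= -(rmorph_nat Phi0) Phi0q.
(* Some conjugate of [theta] reduces to [u]; composing the place with [t] makes [theta] itself do
   so. *)
have [t Dt]: exists t, Phi0 (autZ t theta) = u%:~R.
  have: Phi0 (map_poly intr g).[u%:~R] = 0.
    apply/eqP; rewrite horner_map rmorph_int (intr_eq0_pchar _ qk).
    by move: q_gu; rewrite dvdzE.
  rewrite Dg horner_prod rmorph_prod => /eqP; rewrite prodf_seq_eq0.
  case/hasP=> y /orbP[t ->] /=; rewrite hornerXsubC rmorphB rmorph_int subr_eq0.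
  by move/eqP=> e; exists t.
have [Phi Phi_theta]: exists Phi : {rmorphism Zbar -> k}, Phi theta = u%:~R.
  by exists (Phi0 \o autZ t).
have Phi_orb y z : y \in orb -> z \in orb -> Phi y = Phi z -> y = z.
  move=> orb_y orb_z e; apply: contraNeq qd => ne_yz.
  rewrite -(intr_eq0_pchar _ qk) -(rmorph_int Phi) -Dd (big_rem y) //= /E.
  rewrite (big_rem z) //= [z == y]eq_sym ne_yz !(rmorphM Phi) (rmorphB Phi).
  by rewrite e subrr !mul0r.
have orb_aut s : autZ s theta \in orb.
  by rewrite -(perm_mem (perm_orb s)); apply: map_f.
have Phi_s s : Phi (autZ s theta) = Phi theta -> autZ s theta = theta by apply: Phi_orb.
exists q, k, Phi; split=> // [xs|].
  have [s Ds] := frobenius_lift Phi qk (theta :: xs); exists s; split; last first.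
    by move=> x xsx; apply: Ds; rewrite inE xsx orbT.
  apply: Phi_s; rewrite Ds ?mem_head // Phi_theta -(pFrobenius_autE qk).
  exact: rmorph_int.
(* If [s] moves [theta], then [theta] is the image under [s] of another conjugate, and the
   corresponding factor becomes [u%:~R - theta], which reduces to 0. *)
exists (\prod_(y <- orb | y != theta) (u%:~R - y)); split.
- rewrite rmorph_prod prodf_seq_neq0; apply/allP => y orb_y /=; apply/implyP.
  rewrite rmorphB rmorph_int -Phi_theta subr_eq0; apply: contraNneq => e.
  by apply/eqP/Phi_orb.
- move=> s s_theta; rewrite rmorph_prod -[RHS](perm_big _ (perm_orb s)) big_map.
  apply: eq_big => [y|y _]; last by rewrite rmorphB rmorph_int.
  by rewrite -{2}s_theta (inj_eq (@autZ_inj s)).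
move=> s s_theta; have: theta \in [seq autZ s y | y <- orb] by rewrite (perm_mem (perm_orb s)).
case/mapP=> y orb_y e; rewrite rmorph_prod rmorph_prod (big_rem y) //= ifT.
  have -> : autZ s (u%:~R - y) = u%:~R - theta by rewrite rmorphB rmorph_int e.
  by rewrite rmorphB rmorph_int Phi_theta subrr mul0r.
by apply: contra_notN s_theta => /eqP {1}<-.
Qed.

(** * Kummer extensions with descent *)

(** If [a] clears the denominators of the minimal polynomial, of degree d with coefficients p_i,
    then the multiple of [x] by [a] is a root of the monic polynomial with integral coefficients p_i
    a^(d-i). *)
Lemma Aint_multiple (x : algC) : exists2 a : int, a != 0 & a%:~R * x \in Aint.
Proof.
have [p [Dp mon_p] _] := minCpolyP x.
have [q [a nz_a Dq]] := rat_poly_scale p; exists a => //.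
pose d := (size p).-1.
have sz_p : size p = d.+1 by rewrite prednK // size_poly_gt0 monic_neq0.
pose R := \poly_(i < d.+1) (ratr p`_i * a%:~R ^+ (d - i) : algC).
have pd1 : p`_d = 1 by rewrite -(monicP mon_p) lead_coefE sz_p.
have Rd : R`_d = 1 by rewrite coef_poly ltnSn subnn pd1 rmorph1 mulr1.
have sz_R : size R = d.+1.
  apply/anti_leq; rewrite size_poly ltnNge; apply/negP => le_d.
  by move: Rd; rewrite nth_default // => /esym/eqP; rewrite oner_eq0.
apply: (@root_monic_Aint R).
- apply/rootP; transitivity (a%:~R ^+ d * (minCpoly x).[x]); last first.
    by rewrite (rootP (root_minCpoly x)) mulr0.
  rewrite horner_poly Dp horner_coef size_map_poly sz_p mulr_sumr.
  apply: eq_bigr => i _; rewrite coef_map /= exprMn.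
  have -> : a%:~R ^+ d = a%:~R ^+ (d - i) * a%:~R ^+ i :> algC.
    by rewrite -exprD subnK // -ltnS.
  by rewrite [RHS]mulrACA [_ * ratr _]mulrC.
- by rewrite monicE lead_coefE sz_R Rd.
apply/polyOverP=> i; rewrite coef_poly; case: ltnP => lti; last exact: rpred0.
have [->|ne_id] := eqVneq i d; first by rewrite subnn pd1 rmorph1 mulr1 rpred1.
have lt_id : (i < d)%N by rewrite ltn_neqAle ne_id.
rewrite -(subnSK lt_id) exprS mulrA rpredM ?rpredX ?rpred_int //.
suff -> : ratr p`_i * a%:~R = (q`_i)%:~R :> algC by rewrite rpred_int.
rewrite Dq coefZ coef_map /= mulrC rmorphM fmorphV !rmorph_int mulrA divff ?mul1r //.
by rewrite intr_eq0.
Qed.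

Lemma stab_Zbar (U : aut -> Prop) :
  open_subgroup U -> exists theta : Zbar, forall s, U s <-> autZ s theta = theta.
Proof.
move=> oU; have [x Hx] := open_subgroup_stab oU.
have [a nz_a Iax] := Aint_multiple x; pose theta : Zbar := Sub (a%:~R * x) Iax.
exists theta => s; rewrite Hx; split=> [sx|/(congr1 val)].
  by apply: val_inj; rewrite val_autZ SubK rmorphM rmorph_int sx.
rewrite val_autZ SubK rmorphM rmorph_int; apply: mulfI.
by rewrite intr_eq0.
Qed.

Lemma Aint_root (r : nat) (x : algC) : (0 < r)%N -> x ^+ r \in Aint -> x \in Aint.
Proof.
move=> r_gt0 Ixr; pose p := minCpoly (x ^+ r).
have sz_X : (1 < size ('X^r : {poly algC}))%N by rewrite size_polyXn ltnS.
apply: (@root_monic_Aint (p \Po 'X^r)).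
- by rewrite root_comp hornerXn root_minCpoly.
- by rewrite monicE lead_coef_comp // lead_coefXn expr1n mulr1 -monicE minCpoly_monic.
by rewrite polyOver_comp ?rpredX ?polyOverX.
Qed.

Lemma Zbar_root (r : nat) (x : Zbar) : (0 < r)%N -> exists y : Zbar, y ^+ r = x.
Proof.
move=> r_gt0; have Iy : r.-root (val x) \in Aint.
  by apply: (Aint_root r_gt0); rewrite rootCK // (valP x).
pose y : Zbar := Sub (r.-root (val x)) Iy.
have Dy : val y = r.-root (val x) := SubK _ _.
by exists y; apply: val_inj; rewrite -(rootCK r_gt0 (val x)) -Dy rmorphXn.
Qed.

Lemma natr_inj_pchar (k : fieldType) (q i j : nat) :
  q \in [pchar k] -> (i < q)%N -> (j < q)%N -> i%:R = j%:R :> k -> i = j.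
Proof.
move=> qk; wlog le_ij : i j / (i <= j)%N.
  by move=> IH lti ltj e; case: (leqP i j) => [|/ltnW] le; [|symmetry]; apply: IH.
move=> _ ltj /eqP; rewrite eq_sym -subr_eq0 -natrB // -(dvdn_pcharf qk) => dv.
apply/eqP; rewrite eqn_leq le_ij -subn_eq0 andTb; apply: contraLR dv => nz.
by rewrite gtnNdvd ?lt0n // (leq_ltn_trans (leq_subr _ _)).
Qed.

(** The natural numbers below [q] already give [q] roots of ['X^q - 'X], which can have no other. *)
Lemma frobenius_fixed_nat (k : fieldType) (q : nat) (x : k) :
  q \in [pchar k] -> x ^+ q = x -> exists c : nat, x = c%:R.
Proof.
move=> qk xq; have pr_q := pcharf_prime qk.
pose ns : seq k := [seq i%:R | i <- iota 0 q].
have [/mapP[c _ ->]|nsx] := boolP (x \in ns); first by exists c.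
have sz_P : size ('X^q - 'X : {poly k}) = q.+1.
  by rewrite size_polyDl size_polyXn // size_polyN size_polyX ltnS prime_gt1.
have nzP : 'X^q - 'X != 0 :> {poly k} by rewrite -size_poly_eq0 sz_P.
have := @max_poly_roots _ ('X^q - 'X) (x :: ns) nzP.
rewrite sz_P /= size_map size_iota ltnn => absurd; suff: false by []; apply: absurd.
  rewrite rootE !hornerE xq subrr eqxx /=; apply/allP=> _ /mapP[i _ ->].
  by rewrite rootE !hornerE -(pFrobenius_autE qk) pFrobenius_aut_nat subrr.
rewrite nsx map_inj_in_uniq ?iota_uniq // => i j; rewrite !mem_iota !add0n.
exact: natr_inj_pchar.
Qed.

(** The nonzero elements of the prime field are [q.-1] distinct roots of unity, so one of them is
    primitive. *)
Lemma primitive_nat_root (k : fieldType) (q : nat) :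
  q \in [pchar k] -> exists c : nat, q.-1.-primitive_root (c%:R : k).
Proof.
move=> qk; have pr_q := pcharf_prime qk.
pose ns : seq k := [seq i%:R | i <- iota 1 q.-1].
have nz_ns i : i \in iota 1 q.-1 -> (i%:R : k) != 0.
  rewrite mem_iota add1n prednK ?(prime_gt0 pr_q) // => /andP[i_gt0 ltiq].
  by rewrite -(dvdn_pcharf qk) gtnNdvd.
have: has q.-1.-primitive_root ns.
  apply: has_prim_root; rewrite ?size_map ?size_iota -?subn1 ?subn_gt0 ?(prime_gt1 pr_q) //.
    apply/allP=> _ /mapP[i /nz_ns nz_i ->]; rewrite unity_rootE subn1.
    apply/eqP/(mulIf nz_i); rewrite mul1r -exprSr prednK ?(prime_gt0 pr_q) //.
    by rewrite -(pFrobenius_autE qk) pFrobenius_aut_nat.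
  rewrite map_inj_in_uniq ?iota_uniq // => i j.
  rewrite !mem_iota !add1n ?subn1 prednK ?(prime_gt0 pr_q) // => /andP[_ ?] /andP[_ ?].
  by apply: natr_inj_pchar qk _ _. 
by case/hasP=> _ /mapP[c _ ->] prim_c; exists c.
Qed.

Lemma autZM s t x : autZ (autM s t) x = autZ s (autZ t x).
Proof. by apply: val_inj; rewrite !val_autZ. Qed.

Lemma autZVK s x : autZ (autV s) (autZ s x) = x.
Proof. by apply: val_inj; rewrite !val_autZ autVK. Qed.

Lemma autZKV s x : autZ s (autZ (autV s) x) = x.
Proof. by apply: val_inj; rewrite !val_autZ autKV. Qed.

Lemma autZ_ext (s t : aut) x : s =1 t -> autZ s x = autZ t x.
Proof. by move=> e; apply: val_inj; rewrite !val_autZ e. Qed.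

Lemma Zbar_val_eq0 (x : Zbar) : (val x == 0) = (x == 0).
Proof. by rewrite -(inj_eq val_inj) rmorph0. Qed.

(** * The cyclotomic character modulo [r] *)

Section CyclotomicCharacter.
Variables (r' : nat) (z : Zbar).
Local Notation r := r'.+2.
Hypothesis prim_z : r.-primitive_root (val z).

Lemma zeta_expr_order : z ^+ r = 1.
Proof. by apply: val_inj; rewrite rmorphXn (prim_expr_order prim_z). Qed.

Lemma zetaD (a b : 'Z_r) : z ^+ (a + b)%R = z ^+ a * z ^+ b.
Proof. by rewrite -exprD -(expr_mod (a + b) zeta_expr_order). Qed.

Lemma zetaM (a b : 'Z_r) : z ^+ (a * b)%R = (z ^+ a) ^+ b.
Proof. by rewrite -exprM -(expr_mod (a * b) zeta_expr_order). Qed.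

Lemma zeta_inj (x : Zbar) (a b : 'Z_r) :
  x != 0 -> z ^+ a * x = z ^+ b * x -> a = b.
Proof.
rewrite -Zbar_val_eq0 => nzx /(congr1 val).
rewrite !rmorphM !rmorphXn => /(mulIf nzx)/eqP.
by rewrite (eq_prim_root_expr prim_z) !modn_small ?ltn_ord // => /eqP/val_inj.
Qed.

Lemma zeta_quotient (x y : Zbar) :
  y != 0 -> x ^+ r = y ^+ r -> exists a : 'Z_r, x = z ^+ a * y.
Proof.
move=> nzy exy; have nzvy : val y != 0 by rewrite Zbar_val_eq0.
have: (val x / val y) ^+ r = 1.
  by rewrite expr_div_n -!rmorphXn exy divff // rmorphXn expf_neq0.
case/(prim_rootP prim_z)=> a e; exists a; apply: val_inj.
by rewrite rmorphM rmorphXn -e divfK.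
Qed.

(** Logarithm to base [z] of the quotient of [x] by [y], with default value 0 when the quotient is
    not a power of [z]. *)
Definition zlog (x y : Zbar) : 'Z_r :=
  if pselect (exists a : 'Z_r, x = z ^+ a * y) is left e then projT1 (cid e) else 0.

Lemma zlogK (x y : Zbar) : y != 0 -> x ^+ r = y ^+ r -> x = z ^+ zlog x y * y.
Proof.
move=> nzy /(zeta_quotient nzy) ex; rewrite /zlog; case: pselect => // e.
by case: cid.
Qed.

Lemma zlogE (a : 'Z_r) (y : Zbar) : y != 0 -> zlog (z ^+ a * y) y = a.
Proof.
move=> nzy; rewrite /zlog; case: pselect => [e|[]]; last by exists a.
by case: cid => b /= /(zeta_inj nzy).
Qed.

(** The cyclotomic character. Writing [r] as [r'.+2] makes ['Z_r] the ring of integers modulo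
    [r]. *)
Definition chi (s : aut) : 'Z_r := zlog (autZ s z) 1.

Lemma chiP s : autZ s z = z ^+ chi s.
Proof.
rewrite -[RHS]mulr1 -zlogK ?oner_neq0 // expr1n.
by rewrite -rmorphXn zeta_expr_order rmorph1.
Qed.

Lemma chi_unique s (a : 'Z_r) : autZ s z = z ^+ a -> chi s = a.
Proof. by rewrite /chi => ->; rewrite -[X in zlog X]mulr1 zlogE ?oner_neq0. Qed.

Lemma chi_ext (s t : aut) : s =1 t -> chi s = chi t.
Proof. by move=> e; rewrite /chi (autZ_ext _ e). Qed.

Lemma chiM s t : chi (autM s t) = chi s * chi t.
Proof. by apply: chi_unique; rewrite autZM (chiP t) rmorphXn /= chiP zetaM. Qed.

Lemma chi1P s : chi s = 1 <-> autZ s z = z.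
Proof. by split=> [e|e]; [rewrite chiP e expr1|apply: chi_unique; rewrite e expr1]. Qed.

Lemma chiVr s : chi (autV s) * chi s = 1.
Proof. by rewrite -chiM; apply/chi1P; rewrite autZM autZVK. Qed.

Lemma chi_unit s : chi s \is a GRing.unit.
Proof. by apply/unitrPr; exists (chi (autV s)); rewrite mulrC chiVr. Qed.

End CyclotomicCharacter.

(** * Frobenius acting on roots of unity and on [r]-th roots *)

Section ReducedRoots.
Variables (r' : nat) (z : Zbar).
Local Notation r := r'.+2.
Hypothesis prim_z : r.-primitive_root (val z).
Variables (q : nat) (k : fieldType) (Phi : {rmorphism Zbar -> k}).
Hypotheses (qk : q \in [pchar k]) (lt_rq : (r < q)%N).

(** If the order dropped to [m], the sum of the [s] powers of [z ^+ m], with [s] the quotient of [r]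
    by [m], would be zero and yet reduce to [s]; but [s] is positive and below the characteristic
    [q]. *)
Lemma reduced_primitive_root : r.-primitive_root (Phi z).
Proof.
have Phi_zr : Phi z ^+ r = 1 by rewrite -rmorphXn (zeta_expr_order prim_z) rmorph1.
have [m prim_m dv_mr] := prim_order_exists (ltn0Sn _) Phi_zr.
suff -> : r = m by [].
apply: contraTeq lt_rq => ne_rm; rewrite -leqNgt.
have m_gt0 := prim_order_gt0 prim_m.
have r_gt0 : (0 < r)%N by [].
pose s := (r %/ m)%N; pose y := z ^+ m.
have s_gt0 : (0 < s)%N by rewrite divn_gt0 // dvdn_leq.
have ne_y1 : val (y - 1) != 0.
  rewrite Zbar_val_eq0 subr_eq0 -(inj_eq val_inj) rmorphXn rmorph1.
  rewrite -(prim_order_dvd prim_z); apply: contra ne_rm => dv_rm.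
  by rewrite eqn_dvd dv_rm.
have sum0 : \sum_(i < s) y ^+ i = 0.
  have: (y - 1) * (\sum_(i < s) y ^+ i) = 0.
    by rewrite -subrX1 -exprM mulnC divnK // (zeta_expr_order prim_z) subrr.
  move/(congr1 val); rewrite rmorphM rmorph0 => /eqP.
  by rewrite mulf_eq0 (negPf ne_y1) Zbar_val_eq0 => /eqP.
have: (s%:R : k) == 0.
  have Phi_y : Phi y = 1 by rewrite rmorphXn /= (prim_expr_order prim_m).
  move/(congr1 Phi): sum0; rewrite rmorph0 rmorph_sum /= => <-; apply/eqP.
  under eq_bigr => i _ do rewrite rmorphXn /= Phi_y expr1n.
  by rewrite sumr_const card_ord.
rewrite -(dvdn_pcharf qk) => /(dvdn_leq s_gt0) le_qs.
by apply: leq_trans le_qs _; apply: leq_div.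
Qed.

Variable s : aut.
Hypothesis s_z : autZ s z = z.
Hypothesis Phi_sz : Phi (autZ s z) = Phi z ^+ q.

Lemma order_dvd_pred : (r %| q.-1)%N.
Proof.
have q_gt0 : (0 < q)%N by apply: leq_ltn_trans lt_rq.
have prim_Pz := reduced_primitive_root.
rewrite (prim_order_dvd prim_Pz); apply/eqP.
have nz_Pz : Phi z != 0 by rewrite (prim_root_eq0 prim_Pz).
by apply: (mulIf nz_Pz); rewrite -exprSr prednK // -Phi_sz s_z mul1r.
Qed.

(** Euler's criterion for [r]-th powers: [s] multiplies [x] by an [r]-th root of unity, whose
    reduction is the power residue of [x ^+ r]. *)
Lemma frobenius_root (x : Zbar) :
    autZ s (x ^+ r) = x ^+ r -> Phi (autZ s x) = Phi x ^+ q -> Phi (x ^+ r) != 0 ->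
  exists2 a : 'Z_r, autZ s x = z ^+ a * x & Phi z ^+ a = Phi (x ^+ r) ^+ (q.-1 %/ r).
Proof.
move=> s_xr Phi_sx nz_Px.
have q_gt0 : (0 < q)%N by apply: leq_ltn_trans lt_rq.
have {}nz_Px : Phi x != 0.
  by apply: contraNneq nz_Px => e; rewrite rmorphXn /= e expr0n.
have nzx : x != 0 by apply: contraNneq nz_Px => ->; rewrite rmorph0.
have [|a Da] := zeta_quotient prim_z (x := autZ s x) nzx; first by rewrite -s_xr rmorphXn.
exists a => //; apply: (mulIf nz_Px).
rewrite -rmorphXn -rmorphM -Da Phi_sx rmorphXn -exprM [(r * _)%N]mulnC.
by rewrite divnK ?order_dvd_pred // -exprSr prednK.
Qed.

Lemma frobenius_root_fixed (x : Zbar) :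
    autZ s (x ^+ r) = x ^+ r -> Phi (autZ s x) = Phi x ^+ q -> Phi (x ^+ r) = 1 ->
  autZ s x = x.
Proof.
move=> s_xr Phi_sx Pxr1.
have [|a -> ] := frobenius_root s_xr Phi_sx; first by rewrite Pxr1 oner_neq0.
rewrite Pxr1 expr1n => /eqP; rewrite -(prim_order_dvd reduced_primitive_root).
have [-> _|a_gt0] := posnP a; first by rewrite mul1r.
by rewrite gtnNdvd // ltn_ord.
Qed.

(** The power of exponent [q.-1 %/ r] of a primitive root has order exactly [r], so [a] is prime to
    [r]. *)
Lemma frobenius_root_primitive (x : Zbar) :
    autZ s (x ^+ r) = x ^+ r -> Phi (autZ s x) = Phi x ^+ q ->
    q.-1.-primitive_root (Phi (x ^+ r)) ->
  exists2 a : 'Z_r, autZ s x = z ^+ a * x & a \is a GRing.unit.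
Proof.
move=> s_xr Phi_sx prim_w.
have nz_w : Phi (x ^+ r) != 0.
  by rewrite (prim_root_eq0 prim_w) -lt0n (prim_order_gt0 prim_w).
have [a Da Pza] := frobenius_root s_xr Phi_sx nz_w; exists a => //.
have := dvdn_prim_root prim_w order_dvd_pred.
by rewrite -Pza prim_root_exp_coprime ?reduced_primitive_root // -[X in X \is a _]natr_Zp
  unitZpE // coprime_sym.
Qed.
End ReducedRoots.

(** * A Kummer character over the field of [F(zeta_r)], descended to [F] *)

Section KummerDescent.
Variables (r' : nat) (z : Zbar).
Local Notation r := r'.+2.
Hypothesis prim_z : r.-primitive_root (val z).
Variables (F : aut -> Prop) (theta gamma : Zbar).
Hypothesis oF : open_subgroup F.
Hypothesis thetaP : forall s, autZ s theta = theta <-> F s /\ autZ s z = z.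
Hypotheses (nz_gamma : gamma != 0)
  (gamma_fix : forall s, autZ s theta = theta -> autZ s gamma = gamma).

Local Notation chi := (chi r' z).
Local Notation zlog := (zlog r' z).

(** The Galois group of the extension of the field of [F] generated by [z], seen inside the units
    modulo [r]. *)
Definition chi_image : pred 'Z_r := fun i => `[< exists2 s : aut, F s & chi s = i >].
Local Notation D := chi_image.

Definition chi_lift (i : 'Z_r) : aut :=
  if pselect (exists2 s : aut, F s & chi s = i) is left e then projT1 (cid2 e) else idfun.

Lemma chi_liftP i : D i -> F (chi_lift i) /\ chi (chi_lift i) = i.
Proof.
move/asboolP=> e; rewrite /chi_lift; case: pselect => // {}e.
by case: cid2.
Qed.

(** As [gamma] lies in the field generated by [z] over that of [F], its conjugates over the latter
    are indexed by [D]. *)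
Definition gamma_conj i : Zbar := autZ (chi_lift i) gamma.

Definition gamma_root i : Zbar := projT1 (cid (Zbar_root (gamma_conj i) (ltn0Sn r'.+1))).

Lemma gamma_rootP i : gamma_root i ^+ r = gamma_conj i.
Proof. by rewrite /gamma_root; case: cid. Qed.

Lemma gamma_conj_neq0 i : gamma_conj i != 0.
Proof. by rewrite -(rmorph0 (autZ (chi_lift i))) (inj_eq (@autZ_inj _)). Qed.

Lemma gamma_root_neq0 i : gamma_root i != 0.
Proof.
by apply: contraNneq (gamma_conj_neq0 i) => e; rewrite -gamma_rootP e expr0n.
Qed.

Lemma chi_imageM s i : F s -> D (chi s * i) = D i.
Proof.
move=> Fs; apply/asboolP/asboolP => -[t Ft e]; last first.
  by exists (autM s t); [apply: (osM oF)|rewrite (chiM prim_z) e].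
exists (autM (autV s) t); first by apply: (osM oF) Ft; apply: (osV oF).
by rewrite (chiM prim_z) e mulrA (chiVr prim_z) mul1r.
Qed.

Lemma gamma_conj_eq (s t : aut) : F s -> F t -> chi s = chi t -> autZ s gamma = autZ t gamma.
Proof.
move=> Fs Ft e; have: autZ (autM (autV t) s) gamma = gamma.
  apply: gamma_fix; apply/thetaP; split; first by apply: (osM oF) Fs; apply: (osV oF).
  by apply/(chi1P prim_z); rewrite (chiM prim_z) e (chiVr prim_z).
by rewrite autZM => /(congr1 (autZ t)); rewrite autZKV.
Qed.

Lemma gamma_conjM s i : F s -> D i -> autZ s (gamma_conj i) = gamma_conj (chi s * i).
Proof.
move=> Fs Di; have [Fi ci] := chi_liftP Di.
have [Fsi csi] : F (chi_lift (chi s * i)) /\ chi (chi_lift (chi s * i)) = chi s * i.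
  by apply: chi_liftP; rewrite chi_imageM.
rewrite /gamma_conj -autZM; apply: gamma_conj_eq => //; first exact: (osM oF).
by rewrite (chiM prim_z) ci csi.
Qed.

(** The chosen [r]-th roots are permuted by [F] only up to powers of [z]; this exponent records the
    defect. *)
Definition kummer_exp (s : aut) i : 'Z_r := zlog (autZ s (gamma_root i)) (gamma_root (chi s * i)).

Lemma kummer_expP s i : F s -> D i ->
  autZ s (gamma_root i) = z ^+ kummer_exp s i * gamma_root (chi s * i).
Proof.
move=> Fs Di; apply: (zlogK prim_z); first exact: gamma_root_neq0.
by rewrite -rmorphXn /= !gamma_rootP gamma_conjM.
Qed.

Lemma kummer_expE s i (a : 'Z_r) : autZ s (gamma_root i) = z ^+ a * gamma_root (chi s * i) ->
  kummer_exp s i = a.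
Proof. by rewrite /kummer_exp => ->; rewrite (zlogE prim_z) ?gamma_root_neq0. Qed.

(** A twisted cocycle relation: the factor [chi s] is the effect of [s] on the power of [z] produced
    by [t]. *)
Lemma kummer_expM s t i : F s -> F t -> D i ->
  kummer_exp (autM s t) i = chi s * kummer_exp t i + kummer_exp s (chi t * i).
Proof.
move=> Fs Ft Di; apply: kummer_expE.
rewrite autZM (kummer_expP Ft Di) rmorphM rmorphXn /= (kummer_expP Fs) ?chi_imageM //.
rewrite (chiP prim_z) -(zetaM prim_z) mulrA -(zetaD prim_z) mulrA.
by rewrite (chiM prim_z).
Qed.

(* The eigenspace twist [i^-1] in the exponents makes this cocycle a
   homomorphism: it is the Kummer character of [prod_i gamma_i^(1/i)]. *)
Definition kummer_char (s : aut) : 'Z_r := \sum_(i | D i) (chi s * i)^-1 * kummer_exp s i.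

Lemma chi_image_unit i : D i -> i \is a GRing.unit.
Proof. by move=> /chi_liftP[_ <-]; apply: chi_unit prim_z _. Qed.

Lemma kummer_charM s t : F s -> F t ->
  kummer_char (autM s t) = kummer_char s + kummer_char t.
Proof.
move=> Fs Ft; have Us := chi_unit prim_z s; have Ut := chi_unit prim_z t.
rewrite /kummer_char addrC.
(* Multiplication by [chi t] permutes [D]; this reindexing aligns the terms of [s] with the shifted
   terms of the cocycle relation. *)
rewrite [X in _ = _ + X](reindex_onto (fun i => chi t * i) (fun i => (chi t)^-1 * i)) /=;
  last by move=> i _; rewrite mulVKr.
rewrite [X in _ = _ + X](eq_bigl D) => [|i]; last first.
  by rewrite mulKr // eqxx andbT chi_imageM.
rewrite -big_split; apply: eq_bigr => i Di; have Ui := chi_image_unit Di.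
rewrite kummer_expM // (chiM prim_z) mulrDr -mulrA; congr (_ + _).
by rewrite [(chi s * _)^-1]invrM ?unitrM ?Ut // mulrA mulrVK.
Qed.

Lemma kummer_char_ext (s t : aut) : s =1 t -> kummer_char s = kummer_char t.
Proof.
move=> e; apply: eq_bigr => i _; rewrite /kummer_exp (chi_ext r' z e).
by rewrite (autZ_ext _ e).
Qed.

Lemma kummer_char1 : kummer_char idfun = 0.
Proof.
have Fid := os_id oF; apply: (addrI (kummer_char idfun)).
rewrite addr0 -kummer_charM //; exact: kummer_char_ext.
Qed.

Lemma kummer_charV s : F s -> kummer_char (autV s) = - kummer_char s.
Proof.
move=> Fs; have FVs := osV oF Fs.
apply: (addIr (kummer_char s)); rewrite addNr -kummer_charM //.
rewrite -kummer_char1; apply: kummer_char_ext => x; exact: autVK.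
Qed.

Lemma kummer_char_fix s : F s -> autZ s z = z ->
  (forall i, D i -> autZ s (gamma_root i) = gamma_root i) -> kummer_char s = 0.
Proof.
move=> Fs /(chi1P prim_z) cs fix_s; rewrite /kummer_char big1 // => i Di.
rewrite (@kummer_expE s i 0) ?mulr0 // fix_s // cs mul1r expr0 mul1r //.
Qed.

Lemma kummer_char_open : open_subgroup (fun s => F s /\ kummer_char s = 0).
Proof.
split.
- by move=> s t e [Fs <-]; split; [apply: (os_ext oF e)|apply: esym; apply: kummer_char_ext].
- by move=> s t [Fs s0] [Ft t0]; rewrite kummer_charM // s0 t0 addr0; split=> //; apply: (osM oF).
- by move=> s [Fs s0]; rewrite kummer_charV // s0 oppr0; split=> //; apply: (osV oF).
have [xs Hxs] := os_open oF.
exists (xs ++ val z :: [seq val (gamma_root i) | i <- enum 'Z_r]) => s fix_s.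
have Fs : F s by apply: Hxs => x xsx; rewrite fix_s // mem_cat xsx.
split=> //; apply: kummer_char_fix => // [|i _]; apply: val_inj; rewrite val_autZ fix_s //.
  by rewrite mem_cat mem_head orbT.
rewrite mem_cat inE; apply/orP; right; apply/orP; right.
by apply/mapP; exists i; rewrite ?mem_enum.
Qed.
End KummerDescent.

Definition autJ (s t : aut) : aut := autM s (autM t (autV s)).

Lemma autZJ s t x : autZ (autJ s t) x = autZ s (autZ t (autZ (autV s) x)).
Proof. by rewrite !autZM. Qed.

Lemma autZ_id x : autZ idfun x = x.
Proof. by apply: val_inj; rewrite val_autZ. Qed.

Lemma autZVV s x : autZ (autV (autV s)) x = autZ s x.
Proof. by rewrite -[x in LHS](autZVK s) autZVK. Qed.

(** The kernel of [psi] defines a cyclic extension of degree [r] of the field of [F], with [sigma]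
    giving a generator. The last clause keeps it from being Galois over the field of [K] when [F] is
    a proper subgroup: some conjugate of [sigma] falls into the kernel, while [sigma] does not. *)
Lemma kummer_exists (r' : nat) (K F : aut -> Prop) :
    open_subgroup K -> open_subgroup F -> (forall s, F s -> K s) ->
    (forall s t, K s -> F t -> F (autJ s t)) ->
  exists (psi : aut -> 'Z_r'.+2) (sigma : aut),
    [/\ forall s t, F s -> F t -> psi (autM s t) = psi s + psi t,
        open_subgroup (fun s => F s /\ psi s = 0),
        F sigma, psi sigma \is a GRing.unit &
        forall tau, K tau -> ~ F tau -> psi (autJ tau sigma) = 0].
Proof.
move=> oK oF subFK normF; set r := r'.+2.
have [z0 prim_z0] := C_prim_root_exists (ltn0Sn r'.+1).
pose z : Zbar := Sub z0 (Aint_prim_root prim_z0).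
have prim_z : r.-primitive_root (val z) by rewrite SubK.
have oFz := open_subgroupI oF (stab_open [:: val z]).
have [theta Htheta] := stab_Zbar oFz.
have thetaP s : autZ s theta = theta <-> F s /\ autZ s z = z.
  rewrite -Htheta; split=> -[Fs sz]; split=> //.
    by apply: val_inj; rewrite val_autZ; apply/stab1P.
  by apply/stab1P; rewrite -val_autZ sz.
have [q [k [Phi [pr_q lt_rq qk frob [H [nz_H H_fix H_moved]]]]]] := place_exists theta r.
have [c0 prim_w] := primitive_nat_root qk.
(* The value of [c] is solved from [1 + c * Phi H = c0] in the residue field. Being fixed by
   Frobenius it lifts to a natural number, so [gamma] inherits the Galois behaviour of [H]. *)
have [c Dc]: exists c : nat, (c0%:R - 1) / Phi H = c%:R :> k.
  apply: (frobenius_fixed_nat qk).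
  have [s [s_theta /(_ H)]] := frob [:: H].
  rewrite (H_fix _ s_theta) mem_head => /(_ isT) e.
  rewrite expr_div_n -e -(pFrobenius_autE qk) rmorphB rmorph1.
  by rewrite rmorph_nat.
pose gamma : Zbar := 1 + c%:R * H.
have Phi_gamma : Phi gamma = c0%:R.
  by rewrite rmorphD rmorph1 rmorphM rmorph_nat -Dc divfK // addrC subrK.
have gamma_fix s : autZ s theta = theta -> autZ s gamma = gamma.
  by move=> /H_fix e; rewrite rmorphD rmorph1 rmorphM rmorph_nat /= e.
have gamma_moved s : autZ s theta <> theta -> Phi (autZ s gamma) = 1.
  move=> /H_moved e; rewrite [autZ s _]rmorphD rmorph1 rmorphM rmorph_nat /=.
  by rewrite rmorphD rmorph1 rmorphM /= e mulr0 addr0.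
have nz_gamma : gamma != 0.
  apply: contraTneq (prim_order_gt0 prim_w) => g0.
  by rewrite -Phi_gamma g0 rmorph0 in prim_w; rewrite lt0n -(prim_root_eq0 prim_w) eqxx.
pose g : 'Z_r -> Zbar := gamma_root z F gamma.
pose psi := kummer_char r' z F gamma.
(* Frobenius must be lifted at once on all conjugates of the roots, since the last clause also
   involves their images under [autV tau]. *)
have [Cs HCs]: exists Cs : seq Zbar, forall s i, autZ s (g i) \in Cs.
  have e i := Zbar_orbit_finite (g i).
  exists (flatten [seq projT1 (cid (e i)) | i <- enum 'Z_r]) => s i.
  apply/flattenP; exists (projT1 (cid (e i))); last by case: cid => /=.
  by apply/mapP; exists i; rewrite ?mem_enum.
have [sigma [s_theta Phi_s]] := frob (z :: Cs).
have [Fs s_z] := (thetaP sigma).1 s_theta.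
have Phi_sz : Phi (autZ sigma z) = Phi z ^+ q by apply: Phi_s; apply: mem_head.
have Phi_sg t i : Phi (autZ sigma (autZ t (g i))) = Phi (autZ t (g i)) ^+ q.
  by apply: Phi_s; rewrite inE HCs orbT.
have g_r i : g i ^+ r = autZ (chi_lift z F i) gamma := gamma_rootP z F gamma i.
have cs1 : chi r' z sigma = 1 by apply/(chi1P prim_z).
exists psi, sigma; split=> //.
- by move=> s t; apply: (kummer_charM prim_z oF thetaP nz_gamma gamma_fix).
- exact: (kummer_char_open prim_z oF thetaP nz_gamma gamma_fix).
- have D1 : chi_image z F (1 : 'Z_r).
    by apply/asboolP; exists (idfun : aut); [exact: (os_id oF)|apply/(chi1P prim_z)/autZ_id].
  (* Only the term of index 1 survives in [psi sigma], since every other conjugate of [gamma]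
     reduces to 1. *)
  have fix_i i : chi_image z F i -> i != 1 -> autZ sigma (g i) = g i.
    move=> Di ne_i1; have [Fi ci] := chi_liftP Di.
    have fix_gr : autZ sigma (g i ^+ r) = g i ^+ r.
      by rewrite g_r (gamma_conjM prim_z oF thetaP gamma_fix) // cs1 mul1r.
    have Phi_g := Phi_sg idfun i; rewrite autZ_id in Phi_g.
    apply: (frobenius_root_fixed prim_z qk lt_rq s_z Phi_sz fix_gr Phi_g).
    rewrite g_r gamma_moved // => /thetaP[_ /(chi1P prim_z)]; rewrite ci => i1.
    by rewrite i1 eqxx in ne_i1.
  have [F1 c1] := chi_liftP D1.
  have g1_r : g 1 ^+ r = gamma.
    by rewrite g_r gamma_fix //; apply/thetaP; split=> //; apply/(chi1P prim_z).
  have [|||a Da Ua] := frobenius_root_primitive prim_z qk lt_rq s_z Phi_sz (x := g 1).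
  - by rewrite g1_r gamma_fix.
  - by have := Phi_sg idfun 1; rewrite autZ_id.
  - by rewrite g1_r Phi_gamma.
  rewrite /psi /kummer_char (bigD1 1) //= big1 => [|i /andP[Di ne_i1]].
    rewrite cs1 mulr1 invr1 mul1r addr0 (kummer_expE prim_z nz_gamma (a := a)) //.
    by rewrite cs1 mulr1.
  rewrite (kummer_expE prim_z nz_gamma (a := 0)) ?mulr0 // expr0 mul1r cs1 mul1r.
  exact: fix_i.
move=> tau Kt nFt.
have sigma_z t : autZ sigma (autZ t z) = autZ t z.
  by rewrite (chiP prim_z) rmorphXn /= s_z.
apply: (kummer_char_fix prim_z nz_gamma) => [||i Di]; first exact: normF.
  by rewrite autZJ sigma_z autZKV.
(* Outside [F], [t] moves [theta], so the conjugate [autZ t gamma] reduces to 1 and [sigma] fixes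
   its root [y]. *)
have [Fi ci] := chi_liftP Di; pose t := autM (autV tau) (chi_lift z F i).
have KVt : K (autV tau) by apply: (osV oK).
have Kt' : K t by apply: (osM oK) => //; apply: subFK.
have nFt' : ~ F t.
  move=> Ft; apply: nFt; apply: (os_ext oF (s := autM (chi_lift z F i) (autV t))).
    by move=> x /=; apply: (fmorph_inj (autV tau)); rewrite autVK -[RHS](autKV t).
  by apply: (osM oF) => //; apply: (osV oF).
set y := autZ (autV tau) (g i).
have y_r : y ^+ r = autZ t gamma by rewrite -rmorphXn /= g_r -autZM.
suff s_y : autZ sigma y = y by rewrite autZJ s_y autZKV.
apply: (frobenius_root_fixed prim_z qk lt_rq s_z Phi_sz) => //.
- rewrite y_r -[LHS](autZKV t); congr (autZ t _).
  rewrite -(autZVV t gamma) -autZJ; apply: gamma_fix; apply/thetaP.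
  split; first by apply: normF => //; apply: (osV oK).
  by rewrite autZJ sigma_z autZKV.
- exact: Phi_sg.
by rewrite y_r gamma_moved // => /thetaP[].
Qed.

(** * Polynomials with prescribed reductions *)

(** Minimal polynomial of a generator of the field with [p ^ d] elements. *)
Lemma Fp_irreducible_exists (p d : nat) : prime p -> (0 < d)%N ->
  exists h : {poly 'F_p}, [/\ h \is monic, size h = d.+1 & irreducible_poly h].
Proof.
move=> pr_p d_gt0; have [Fm pF card_F] := pPrimePowerField pr_p d_gt0.
pose L : splittingFieldType 'F_p := pPrimeCharType pF.
have dimL : \dim {:L} = d.
  by rewrite (pprimeChar_dimf pF) card_F pfactorK.
have sepL : separable 1%AS {:L} by have /and3P[] := finField_galois (subvf (1%AS : {subfield L})).
have genL := esym (eq_adjoin_separable_generator sepL (sub1v _)).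
set x := separable_generator _ _ in genL.
have [h Dh] : exists h, minPoly 1 x = map_poly (in_alg L) h.
  exact/polyOver1P/minPolyOver.
have sz_h : size h = d.+1.
  rewrite -(size_map_poly (in_alg L)) -Dh size_minPoly adjoin_degreeE genL dimL.
  by rewrite dimv1 divn1.
exists h; split=> //; first by rewrite -(map_monic (in_alg L)) -Dh monic_minPoly.
split=> [|g sz_g gh]; first by rewrite sz_h.
have Lg : map_poly (in_alg L) g \is a polyOver 1%VS by apply/polyOver1P; exists g.
have := @minPoly_irr _ _ 1%AS x _ Lg; rewrite Dh dvdp_map gh => /(_ isT)/orP[|].
  by rewrite eqp_map.
by rewrite -size_poly_eq1 size_map_poly (negPf sz_g).
Qed.

(** Only the coefficients below ['X^m] go through the Chinese remainder theorem, which keeps the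
    lift monic. *)
Lemma crt_poly (p q m : nat) (f1 : {poly 'F_p}) (f2 : {poly 'F_q}) :
    prime p -> prime q -> p != q -> f1 \is monic -> f2 \is monic ->
    size f1 = m.+1 -> size f2 = m.+1 ->
  exists f : {poly int}, [/\ f \is monic, size f = m.+1,
    map_poly intr f = f1 & map_poly intr f = f2].
Proof.
move=> pr_p pr_q ne_pq mon1 mon2 sz1 sz2.
have co_pq : coprime p q by rewrite prime_coprime // dvdn_prime2.
pose c i := chinese p q (f1`_i)%R (f2`_i)%R.
pose f : {poly int} := 'X^m + \poly_(i < m) (c i)%:Z.
have sz_c : (size (\poly_(i < m) (c i)%:Z) <= m)%N by apply: size_poly.
have sz_f : size f = m.+1 by rewrite size_polyDl size_polyXn.
have fm : f`_m = 1 by rewrite coefD coefXn eqxx nth_default ?addr0.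
have coef_f (l : nat) (g : {poly 'F_l}) : prime l -> g \is monic -> size g = m.+1 ->
    (forall i, c i = (g`_i)%R %[mod l])%N -> map_poly intr f = g.
  move=> pr_l mon_g sz_g cg; apply/polyP=> i; rewrite coef_map /=.
  have [lt_im|lt_mi|->] := ltngtP i m; last first.
  - by rewrite fm rmorph1 -(monicP mon_g) lead_coefE sz_g.
  - by rewrite !nth_default ?sz_f ?sz_g // rmorph0.
  rewrite coefD coefXn (ltn_eqF lt_im) add0r coef_poly lt_im.
  by rewrite -[LHS](Fp_nat_mod pr_l) cg Fp_nat_mod // natr_Zp.
exists f; split=> //; first by rewrite monicE lead_coefE sz_f fm.
  by apply: coef_f => // i; apply: chinese_modl.
by apply: coef_f => // i; apply: chinese_modr.
Qed.

Lemma Zbar_split (f : {poly int}) : f \is monic ->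
  exists rts : seq Zbar, map_poly intr f = \prod_(y <- rts) ('X - y%:P).
Proof.
move=> mon_f; have [cs Dcs] := closed_field_poly_normal (map_poly intr f : {poly algC}).
rewrite lead_coef_map_inj ?rmorph0 // in Dcs; last exact: intr_inj.
rewrite (monicP mon_f) scale1r in Dcs.
have Ics y : y \in cs -> y \in Aint.
  move=> cs_y; apply: (@root_monic_Aint (map_poly intr f)).
  - by rewrite Dcs root_prod_XsubC.
  - exact: monic_map.
  by apply/polyOverP=> i; rewrite coef_map rpred_int.
exists [seq insubd (0 : Zbar) y | y <- cs].
pose toC : {rmorphism Zbar -> algC} := val.
apply: (map_inj_poly (f := toC) val_inj (rmorph0 _)).
transitivity (map_poly intr f : {poly algC}).
  by rewrite -map_poly_comp; apply: eq_map_poly => i; exact: (rmorph_int toC).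
rewrite rmorph_prod big_map Dcs big_seq [RHS]big_seq; apply: eq_bigr => y /Ics Iy.
rewrite -[RHS]/(map_poly toC _) map_polyXsubC; congr (_ - _%:P).
by apply: esym; apply: insubdK.
Qed.

Lemma Fp_embedding (k : fieldType) (p : nat) :
  p \in [pchar k] -> exists e : {rmorphism 'F_p -> k}, injective e.
Proof.
move=> pk; pose e : {rmorphism 'F_p -> pPrimeCharType pk} := in_alg (pPrimeCharType pk).
by exists e; apply: fmorph_inj.
Qed.

(** * Factorisation modulo a prime and the Galois action on the roots *)

Section ReducedPolynomial.
Variables (p : nat) (k : fieldType) (Phi : {rmorphism Zbar -> k}).
Hypothesis pk : p \in [pchar k].
Variable e : {rmorphism 'F_p -> k}.
Variables (f : {poly int}) (fp : {poly 'F_p}) (rts : seq Zbar).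
Hypotheses (Dfp : map_poly intr f = fp)
  (Drts : map_poly intr f = \prod_(y <- rts) ('X - y%:P)).
Hypothesis rts_stable : forall (s : aut) y, y \in rts -> autZ s y \in rts.
Variables (G : aut -> Prop) (sigma : aut).
Hypotheses (G1 : G idfun) (GM : forall s t, G s -> G t -> G (autM s t)).
Hypotheses (Gsigma : G sigma)
  (frob : forall y, y \in rts -> Phi (autZ sigma y) = Phi y ^+ p).

Lemma reduced_split : map_poly e fp = \prod_(y <- rts) ('X - (Phi y)%:P).
Proof.
transitivity (map_poly Phi (map_poly intr f)).
  by rewrite -Dfp; apply/polyP=> i; rewrite !coef_map /= !rmorph_int.
rewrite Drts rmorph_prod; apply: eq_bigr => y _.
by rewrite /= map_polyXsubC.
Qed.

Lemma frobenius_fixed_poly (h : {poly k}) :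
  map_poly (pFrobenius_aut pk) h = h -> exists h0 : {poly 'F_p}, h = map_poly e h0.
Proof.
move=> Fh; have nat_h i : exists c : nat, h`_i = c%:R.
  apply: (frobenius_fixed_nat pk); rewrite -(pFrobenius_autE pk).
  by rewrite -[in RHS]Fh coef_map.
pose c i := projT1 (cid (nat_h i)); exists (\poly_(i < size h) (c i)%:R).
apply/polyP=> i; rewrite coef_map coef_poly; case: ltnP => lti.
  by rewrite /= rmorph_nat /c; case: cid.
by rewrite /= rmorph0 nth_default.
Qed.

(** The reduced linear factors of one [G]-orbit have a product invariant under Frobenius. It
    descends to a divisor of [fp], so irreducibility makes the orbit exhaust the roots. *)
Lemma irreducible_transitive : irreducible_poly fp ->
  uniq rts /\ forall a b, a \in rts -> b \in rts -> exists2 s, G s & autZ s a = b.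
Proof.
move=> irr_fp.
pose S a := undup [seq y <- rts | `[< exists2 s, G s & autZ s a = y >]].
have SP a y : reflect (y \in rts /\ exists2 s, G s & autZ s a = y) (y \in S a).
  by rewrite mem_undup mem_filter andbC; apply: (iffP andP) => -[? /asboolP ?].
have permS a : a \in rts -> perm_eq rts (S a).
  move=> rts_a; have: subseq (S a) rts by apply: subseq_trans (undup_subseq _) (filter_subseq _ _).
  (* Repetitions in [rts] are still possible here; proving [s3] empty excludes them together with a
     second orbit. *)
  case/perm_to_subseq=> s3 perm_rts.
  pose h := \prod_(y <- S a) ('X - (Phi y)%:P).
  have Fh : map_poly (pFrobenius_aut pk) h = h.
    rewrite rmorph_prod /=.
    transitivity (\prod_(y <- [seq autZ sigma y | y <- S a]) ('X - (Phi y)%:P)).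
      rewrite big_map !big_seq; apply: eq_bigr => y /SP[rts_y _].
      by rewrite map_polyXsubC frob //= pFrobenius_autE.
    apply: perm_big; apply: perm_map_stable (undup_uniq _) _; first exact: autZ_inj.
    move=> _ /mapP[y /SP[rts_y [s Gs Dy]] ->]; apply/SP; split; first exact: rts_stable.
    by exists (autM sigma s); [apply: GM|rewrite autZM Dy].
  have [h0 Dh0] := frobenius_fixed_poly Fh.
  have h0_dvd : h0 %| fp.
    by rewrite -(dvdp_map e) reduced_split -Dh0 (perm_big _ perm_rts) big_cat dvdp_mulr.
  have sz_h : size h = (size (S a)).+1 by rewrite size_prod_XsubC.
  have Sa : a \in S a.
    by apply/SP; split=> //; exists idfun => //; apply: val_inj; rewrite val_autZ.
  have sz_h0 : size h0 != 1%N.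
    by rewrite -(size_map_poly e) -Dh0 sz_h; case: (S a) Sa.
  have := eqp_size (irr_fp.2 _ sz_h0 h0_dvd).
  rewrite -(size_map_poly e) -Dh0 sz_h -(size_map_poly e) reduced_split size_prod_XsubC.
  move=> [sz]; move: (perm_size perm_rts).
  rewrite size_cat -sz -[LHS]addn0 => /addnI/esym/size0nil s30.
  by rewrite s30 cats0 in perm_rts.
split=> [|a b rts_a].
  case Drt : rts => [|a rts'] //; rewrite -Drt (perm_uniq (permS a _)) ?undup_uniq //.
  by rewrite Drt mem_head.
by rewrite (perm_mem (permS a rts_a)) => /SP[_].
Qed.

(** A root fixed by Frobenius reduces into the prime field, where [g] has no root; so it reduces to
    0, and 0 is a simple root of [fp]. *)
Lemma fixed_root_unique (g : {poly 'F_p}) :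
    uniq rts -> fp = 'X * g -> irreducible_poly g -> (2 < size g)%N ->
  exists2 a0, a0 \in rts & autZ sigma a0 = a0 /\
    forall b, b \in rts -> autZ sigma b = b -> b = a0.
Proof.
move=> Urts Dfg irr_g sz_g.
have noroot c : ~~ root g c.
  apply/negP=> rgc; have := irr_g.2 ('X - c%:P); rewrite size_XsubC dvdp_XsubCl.
  by move=> /(_ isT rgc)/eqp_size; rewrite size_XsubC => e2; rewrite -e2 in sz_g.
have Drg := reduced_split; rewrite Dfg rmorphM /= map_polyX in Drg.
have: root (map_poly e ('X * g)) 0 by rewrite rmorphM /= map_polyX rootM rootX eqxx.
rewrite -Dfg reduced_split -(big_map Phi predT (fun y => 'X - y%:P)) root_prod_XsubC.
case/mapP=> a0 rts_a0 Phi_a0.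
have uniq0 b : b \in rts -> Phi b = 0 -> b = a0.
  move=> rts_b Phi_b; apply: contraNeq (noroot 0) => ne_ba.
  rewrite -(fmorph_root e) rmorph0.
  have: 'X * map_poly e g = 'X * ('X * \prod_(y <- rem b (rem a0 rts)) ('X - (Phi y)%:P)).
    rewrite Drg (big_rem a0) //= (big_rem b) /=; last by rewrite mem_rem_uniq // !inE ne_ba.
    by rewrite -Phi_a0 Phi_b subr0.
  move/(mulfI (negbT (polyX_eq0 _))) => ->.
  by rewrite rootM rootX eqxx.
exists a0 => //; split=> [|b rts_b fix_b].
  apply: uniq0; first exact: rts_stable.
  by rewrite frob // -Phi_a0 expr0n gtn_eqF // prime_gt0 // (pcharf_prime pk).
have [c Dc] : exists c : nat, Phi b = c%:R.
  by apply: (frobenius_fixed_nat pk); rewrite -frob // fix_b.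
apply: uniq0 => //; apply/eqP.
have: root (map_poly e fp) (Phi b).
  rewrite reduced_split -(big_map Phi predT (fun y => 'X - y%:P)) root_prod_XsubC.
  exact: map_f.
rewrite Dfg rmorphM /= map_polyX rootM rootX => /orP[//|].
by rewrite Dc -(rmorph_nat e) fmorph_root (negPf (noroot _)).
Qed.
End ReducedPolynomial.

(** Irreducibility modulo [p] gives transitivity over the field of [theta]; the factorisation
    ['X * g] modulo [q] gives an automorphism with exactly one fixed root. *)
Lemma generic_roots (theta : Zbar) (m : nat) : (0 < m)%N ->
  exists rts : seq Zbar, [/\ uniq rts, size rts = m,
    forall (s : aut) y, y \in rts -> autZ s y \in rts,
    forall a b, a \in rts -> b \in rts ->
      exists2 s : aut, autZ s theta = theta & autZ s a = b &
    m != 2 -> forall a b, a \in rts -> b \in rts ->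
      (forall s : aut, autZ s theta = theta -> autZ s a = a -> autZ s b = b) -> b = a].
Proof.
case: m => [//|[|m]] _.
  exists [:: 0]; split=> //.
  - by move=> s y; rewrite !inE => /eqP->; rewrite rmorph0.
  - by move=> a b; rewrite !inE => /eqP-> /eqP->; exists idfun; apply: val_inj; rewrite val_autZ.
  - by move=> _ a b; rewrite !inE => /eqP-> /eqP->.
have [p [k [Phi [pr_p _ pk frob_p _]]]] := place_exists theta 0.
have [q [k' [Phi' [pr_q lt_pq qk' frob_q _]]]] := place_exists theta p.
have [f1 [mon_f1 sz_f1 irr_f1]] := Fp_irreducible_exists pr_p (ltn0Sn m.+1).
have [g [mon_g sz_g irr_g]] := Fp_irreducible_exists pr_q (ltn0Sn m).
have mon_Xg : 'X * g \is monic by rewrite rpredM ?monicX.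
have sz_Xg : size ('X * g) = m.+3 by rewrite mulrC size_mulX ?monic_neq0 // sz_g.
have ne_pq : p != q by rewrite ltn_eqF.
have [f [mon_f sz_f Df1 Df2]] := crt_poly pr_p pr_q ne_pq mon_f1 mon_Xg sz_f1 sz_Xg.
have [rts Drts] := Zbar_split mon_f.
have stable (s : aut) y : y \in rts -> autZ s y \in rts.
  move=> rts_y; have: (map_poly intr f).[autZ s y] = 0.
    have -> : map_poly intr f = map_poly (autZ s) (map_poly intr f).
      by apply/polyP=> i; rewrite !coef_map /= rmorph_int.
    rewrite horner_map Drts horner_prod (big_rem y) //= hornerXsubC subrr mul0r.
    exact: rmorph0.
  rewrite Drts horner_prod => /(congr1 val); rewrite rmorph_prod rmorph0 => /eqP.
  rewrite prodf_seq_eq0 => /hasP[x rts_x /andP[_]].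
  by rewrite Zbar_val_eq0 hornerXsubC subr_eq0 => /eqP->.
have [e1 _] := Fp_embedding pk; have [e2 _] := Fp_embedding qk'.
have [s1 [fix_s1 frob1]] := frob_p rts; have [s2 [fix_s2 frob2]] := frob_q rts.
pose G (s : aut) := autZ s theta = theta.
have G1 : G idfun by apply: val_inj; rewrite val_autZ.
have GM s t : G s -> G t -> G (autM s t) by move=> Gs Gt; rewrite /G autZM Gt Gs.
have [Urts trans] := irreducible_transitive pk e1 Df1 Drts stable G1 GM fix_s1 frob1 irr_f1.
exists rts; split=> //.
  have := sz_f; rewrite -(size_map_inj_poly Zbar_intr_inj (rmorph0 _)) Drts.
  by rewrite size_prod_XsubC => -[].
move=> m2 a b rts_a rts_b fix_b.
(* Excluding total degree 2 is what makes the degree of [g] at least 2. *)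
have sz_g2 : (2 < size g)%N by rewrite sz_g; case: (m) m2.
have [a0 rts_a0 [fix_a0 uniq_a0]] :=
  fixed_root_unique qk' e2 Df2 Drts stable frob2 Urts erefl irr_g sz_g2.
have [t fix_t Dt] := trans _ _ rts_a0 rts_a.
have Vt : autZ (autV t) theta = theta by rewrite -{1}fix_t autZVK.
rewrite -Dt -[b](autZKV t); congr (autZ t _); apply: uniq_a0; first exact: stable.
(* The conjugate of [s2] by [t] fixes [a], hence [b]; thus [s2] fixes the preimage of [b] under
   [t]. *)
have := fix_b (autM t (autM s2 (autV t))); rewrite !autZM Vt fix_s2 fix_t -Dt autZVK fix_a0.
by move=> /(_ erefl erefl)/(congr1 (autZ (autV t))); rewrite autZVK.
Qed.

(** * Construction of the polynomial *)

Definition fixes (L : fieldExtType rat) (iota : {rmorphism L -> algC}) (s : aut) :=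
  forall x : L, s (iota x) = iota x.

Definition num_field_gens (L : fieldExtType rat) (iota : {rmorphism L -> algC}) :=
  [seq iota x | x <- vbasis {:L}].

Lemma stab_gens (L : fieldExtType rat) (iota : {rmorphism L -> algC}) s :
  stab (num_field_gens iota) s <-> fixes iota s.
Proof.
split=> [sL x|sL _ /mapP[x _ ->]]; last exact: sL.
rewrite (coord_vbasis (memvf x)) !rmorph_sum; apply: eq_bigr => i _.
rewrite !rmorphZ_num rmorphM fmorph_rat sL //.
by apply/map_f/mem_nth; rewrite size_tuple.
Qed.

Lemma fixes_open (L : fieldExtType rat) (iota : {rmorphism L -> algC}) :
  open_subgroup (fixes iota).
Proof.
have oG := stab_open (num_field_gens iota).
split=> [s t e /stab_gens/(os_ext oG e)/stab_gens //
  | s t /stab_gens Gs /stab_gens Gt | s /stab_gens Gs | ].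
- by apply/stab_gens; apply: (osM oG).
- by apply/stab_gens; apply: (osV oG).
- by exists (num_field_gens iota) => s /stab_gens.
Qed.

(** * From a coset space to an irreducible polynomial *)

Section Realisation.
Variables (L : fieldExtType rat) (iota : {rmorphism L -> algC}).
Variables (V : aut -> Prop) (I : finType) (nu : I -> aut).
Hypotheses (oV : open_subgroup V) (VL : forall s, V s -> fixes iota s).
Hypothesis nuL : forall i, fixes iota (nu i).
Hypothesis nu_cover : forall s, fixes iota s -> exists i, V (autM (autV (nu i)) s).
Hypothesis nu_inj : forall i j, V (autM (autV (nu i)) (nu j)) -> i = j.

(** With [V] the stabiliser of [x], the polynomial is the minimal polynomial of [x], and cosets
    correspond to its roots. A root lies in the field of [x] exactly when [V] fixes it; conjugation
    by [nu i] transports this to any other root. *)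
Lemma realise_cluster :
  exists f : {poly L},
    [/\ irreducible_poly f, size f = #|I|.+1 &
        forall alpha : algC, root (map_poly iota f) alpha ->
          cluster_size iota f alpha
            #|[set i | `[< forall v, V v -> V (autM (autV (nu i)) (autM v (nu i))) >]]|].
Proof.
have oL := fixes_open iota.
have [x Hx] := open_subgroup_stab oV.
pose ys := [seq nu i x | i <- enum I].
have Vx (s t : aut) : V (autM (autV s) t) <-> t x = s x.
  by rewrite Hx /=; split=> [e|->]; [rewrite -[in RHS]e autKV|rewrite autVK].
have inj_nux : injective (fun i => nu i x).
  by move=> i j e; apply: nu_inj; apply/Vx.
have Uys : uniq ys by rewrite map_inj_uniq ?enum_uniq.
have ysP s : fixes iota s -> s x \in ys.
  by case/nu_cover=> i /Vx ->; apply/mapP; exists i; rewrite ?mem_enum.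
have ysM s y : fixes iota s -> y \in ys -> s y \in ys.
  move=> Ls /mapP[i _ ->]; exact: (ysP (autM s (nu i)) (osM oL Ls (nuL i))).
pose P := \prod_(y <- ys) ('X - y%:P).
have PL s : fixes iota s -> map_poly s P = P.
  move=> Ls; rewrite rmorph_prod /=.
  under eq_bigr => y _ do rewrite map_polyXsubC.
  rewrite -(big_map s predT (fun y => 'X - y%:P)); apply: perm_big.
  apply: (perm_map_stable (@fmorph_inj _ _ s) Uys).
  by move=> _ /mapP[y ysy ->]; apply: ysM.
have coefP i : exists c, P`_i = iota c.
  apply: (@fixed_field_pred (fun z => exists c, z = iota c) _ _ _ _ (num_field_gens iota)).
  - by exists 1; rewrite rmorph1.
  - by move=> _ _ [c ->] [d ->]; exists (c - d); rewrite rmorphB.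
  - by move=> _ _ [c ->] [d ->]; exists (c * d); rewrite rmorphM.
  - by move=> _ [c ->]; exists c^-1; rewrite fmorphV.
  - by move=> _ /mapP[c _ ->]; exists c.
  - by move=> s /stab_gens Ls; rewrite -coef_map PL.
have [toL toL0 iotaK] := num_field_proj iota.
pose f := map_poly toL P.
have fP : map_poly iota f = P.
  apply/polyP=> i; rewrite coef_map coef_map_id0 //.
  by have [c ->] := coefP i; rewrite iotaK.
have szf : size f = #|I|.+1.
  by rewrite -(size_map_poly iota) fP size_prod_XsubC size_map -cardE.
have fn0 : f != 0 by rewrite -size_poly_eq0 szf.
have [i0 _] := nu_cover (os_id oL).
exists f; split=> //.
  split=> [|q szq qf]; first by rewrite szf ltnS; apply/card_gt0P; exists i0.
  rewrite /eqp qf -(dvdp_map iota) fP.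
  apply: uniq_roots_dvdp; last by rewrite uniq_rootsE.
  (* An automorphism fixing the base field carries one root of [q] to any prescribed root of [P]. *)
  have /closed_rootP[y ry] : size (map_poly iota q) != 1%N by rewrite size_map_poly.
  have ysy : y \in ys.
    rewrite -root_prod_XsubC -/P -fP -dvdp_XsubCl.
    by apply: (@dvdp_trans _ (map_poly iota q)); rewrite ?dvdp_map ?dvdp_XsubCl.
  apply/allP=> _ /mapP[j _ ->]; case/mapP: ysy ry => i _ -> ri.
  have Lij : fixes iota (autM (nu j) (autV (nu i))).
    by apply: (osM oL) => //; apply: (osV oL).
  have -> : map_poly iota q = map_poly (autM (nu j) (autV (nu i))) (map_poly iota q).
    by rewrite -map_poly_comp; apply: eq_map_poly => c; rewrite /= -[LHS]Lij.
  have -> : nu j x = autM (nu j) (autV (nu i)) (nu i x) by rewrite /= autVK.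
  by rewrite fmorph_root.
set good := [set i | _]; rewrite fP => alpha.
rewrite root_prod_XsubC => /mapP[i _ ->{alpha}].
have goodP k : reflect (forall v, V v -> v (nu k x) = nu k x) (k \in good).
  rewrite inE; apply: (iffP (asboolP _)) => [Vk v /Vk/Vx //|Vk v /Vk e].
  exact/Vx.
exists [seq nu i (nu k x) | k <- enum good]; split.
- by rewrite map_inj_uniq ?enum_uniq // => k l /fmorph_inj/inj_nux.
- by rewrite size_map -cardE.
move=> beta; split=> [/mapP[k kG ->]|].
  split.
    rewrite fP root_prod_XsubC.
    exact: (ysP (autM (nu i) (nu k)) (osM oL (nuL i) (nuL k))).
  move=> S SL Sa SB SM SV.
  apply: (fixed_field_pred _ SB SM SV (xs := nu i x :: num_field_gens iota)).
  - by rewrite -(rmorph1 iota).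
  - by move=> y; rewrite inE => /predU1P[->//|/mapP[c _ ->]].
  move=> s sx; have: V (autM (autV (nu i)) (autM s (nu i))).
    by apply/Vx/sx/mem_head.
  move: kG; rewrite mem_enum => /goodP/[apply] /= /(congr1 (nu i)).
  by rewrite autKV.
case; rewrite fP root_prod_XsubC => ysb adj.
have: autV (nu i) beta \in ys by apply: ysM => //; apply: (osV oL).
case/mapP=> k _ eb; apply/mapP; exists k; last by rewrite -eb autKV.
rewrite mem_enum; apply/goodP => v Vv; rewrite -eb.
(* The fixed points of [w] form a field containing the base field and [nu i x], hence [beta]. *)
pose w := autM (nu i) (autM v (autV (nu i))).
have fixb : w beta = beta.
  apply: (adj (fun z => w z = z)) => [y||y z ey ez|y z ey ez|y ey].
  - exact: (osM oL (nuL i) (osM oL (VL Vv) (osV oL (nuL i)))).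
  - by rewrite /= autVK; move/Hx: Vv => ->.
  - by rewrite rmorphB ey ez.
  - by rewrite rmorphM /= -[in RHS]ey -[in RHS]ez.
  - by rewrite fmorphV ey.
by apply: (fmorph_inj (nu i)); rewrite autKV -[RHS]fixb.
Qed.
End Realisation.

(** * Cosets of the kernel of a character onto ['Z_r] *)

Section CharacterKernel.
Variables (r' : nat) (F : aut -> Prop) (psi : aut -> 'Z_r'.+2) (sigma : aut).
Hypothesis oF : open_subgroup F.
Hypothesis psiM : forall s t, F s -> F t -> psi (autM s t) = psi s + psi t.
Local Notation U := (fun s => F s /\ psi s = 0).
Hypothesis oU : open_subgroup U.
Hypotheses (Fsigma : F sigma) (unit_sigma : psi sigma \is a GRing.unit).

Lemma characterV s : F s -> psi (autV s) = - psi s.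
Proof.
move=> Fs; have FVs := osV oF Fs; apply: (addIr (psi s)); rewrite addNr -psiM //.
suff [] : U (autM (autV s) s) by [].
by apply: (os_ext oU) (os_id oU) => x; rewrite /= autVK.
Qed.

Lemma character_quotient s t : F s -> F t -> U (autM (autV s) t) <-> psi s = psi t.
Proof.
move=> Fs Ft; have FVs := osV oF Fs; rewrite psiM // characterV //.
split=> [[_ /eqP]|->]; first by rewrite addrC subr_eq0 => /eqP.
by rewrite addNr; split=> //; apply: (osM oF).
Qed.

Lemma character_kernel_normal s u : F s -> U u -> U (autM (autV s) (autM u s)).
Proof.
move=> Fs [Fu u0]; have Fus := osM oF Fu Fs.
by apply/(character_quotient Fs Fus); rewrite psiM // u0 add0r.
Qed.

Lemma character_onto j : exists2 s, F s & psi s = j.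
Proof.
have powers (i : nat) : exists2 s, F s & psi s = psi sigma *+ i.
  elim: i => [|i [s Fs Ds]].
    by have [Fid psi0] := os_id oU; exists idfun.
  by exists (autM sigma s); [apply: (osM oF)|rewrite psiM // Ds mulrS].
have [s Fs Ds] := powers (j / psi sigma : 'Z_r'.+2); exists s => //.
by rewrite Ds -mulr_natl natr_Zp divrK.
Qed.
End CharacterKernel.

(** The kernel of a Kummer character with [F] equal to [K]. Index one is separate, as the characters
    take values in ['Z_r'.+2]. *)
Lemma normal_subgroup_of_index (K : aut -> Prop) (r : nat) :
    open_subgroup K -> (0 < r)%N ->
  exists (U : aut -> Prop) (mu : 'I_r -> aut),
    [/\ open_subgroup U, forall s, U s -> K s, forall j, K (mu j),
        forall s, K s -> exists j, U (autM (autV (mu j)) s) &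
        (forall i j, U (autM (autV (mu i)) (mu j)) -> i = j) /\
        forall s u, K s -> U u -> U (autM (autV s) (autM u s))].
Proof.
move=> oK; case: r => [//|[|r']] _.
  exists K, (fun=> idfun); split=> // [j|s Ks|].
  - exact: os_id oK.
  - by exists ord0; apply: (osM oK) Ks; apply/(osV oK)/(os_id oK).
  split=> [i j _|s u Ks Ku]; first by rewrite (ord1 i) (ord1 j).
  by apply: (osM oK); [apply: (osV oK)|apply: (osM oK)].
have normK s t : K s -> K t -> K (autJ s t).
  by move=> Ks Kt; apply: (osM oK) => //; apply: (osM oK) => //; apply: (osV oK).
have [psi [sigma [psiM oU Ks Us _]]] := kummer_exists r' oK oK (fun s Ks => Ks) normK.
have onto := character_onto oK psiM oU Ks Us.
pose mu (j : 'I_r'.+2) := projT1 (cid2 (onto j)).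
have [Kmu Dmu] : (forall j, K (mu j)) /\ forall j, psi (mu j) = j.
  by split=> j; rewrite /mu; case: cid2.
have quot s t := @character_quotient _ _ _ oK psiM oU s t.
exists (fun s => K s /\ psi s = 0), mu; split=> //.
- by move=> s [].
- by move=> s Kss; exists (psi s); apply/quot.
split=> [i j /quot|s u]; first by rewrite !Dmu; apply.
exact: (character_kernel_normal oK psiM oU).
Qed.

Lemma cluster_exists_index_neq2 (L : fieldExtType rat) (iota : {rmorphism L -> algC}) (r m : nat) :
    (0 < r)%N -> (0 < m)%N -> m != 2 ->
  exists f : {poly L},
    [/\ irreducible_poly f, size f = (m * r).+1 &
        forall alpha : algC, root (map_poly iota f) alpha -> cluster_size iota f alpha r].
Proof.
move=> r_gt0 m_gt0 m2; have oL := fixes_open iota.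
have [U [mu [oU UL muL mu_cover [mu_inj normU]]]] := normal_subgroup_of_index oL r_gt0.
have [theta thetaP] := stab_Zbar oU.
have [rts [Urts sz_rts stable trans unique]] := generic_roots theta m_gt0.
pose i0 : 'I_m := Ordinal m_gt0.
pose rt (i : 'I_m) := rts`_i; pose a := rt i0.
have rtP i : rt i \in rts by rewrite mem_nth // sz_rts.
have rt_inj : injective rt.
  by move=> i j /eqP; rewrite nth_uniq ?sz_rts // => /eqP/val_inj.
(* [U] is transitive on the roots, so each coset of [U] has a representative sending [a] to any
   given root. *)
have nu_ex (ji : 'I_r * 'I_m) : exists t : aut, U t /\ autZ (autM (mu ji.1) t) a = rt ji.2.
  have [|t /thetaP Ut Dt] := trans a (autZ (autV (mu ji.1)) (rt ji.2)) (rtP _).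
    exact/stable/rtP.
  by exists t; rewrite autZM Dt autZKV.
pose tt ji := projT1 (cid (nu_ex ji)).
pose nu ji := autM (mu ji.1) (tt ji).
have Utt ji : U (tt ji) by rewrite /tt; case: cid => t [].
have nu_a ji : autZ (nu ji) a = rt ji.2 by rewrite /nu /tt; case: cid => t [].
have nuL ji : fixes iota (nu ji) by apply: (osM oL) => //; apply: UL.
pose V s := U s /\ stab [:: val a] s.
have Va s : stab [:: val a] s <-> autZ s a = a.
  by rewrite stab1P -val_autZ; split=> [/val_inj|->].
have oV : open_subgroup V := open_subgroupI oU (stab_open _).
have nuU ji s : U (autM (autV (nu ji)) s) <-> U (autM (autV (mu ji.1)) s).
  split=> Us.
    apply: (os_ext oU) (osM oU (Utt ji) Us) => x /=.
    by rewrite -[X in _ = _ X](autKV (nu ji)) /= autVK.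
  apply: (os_ext oU) (osM oU (osV oU (Utt ji)) Us) => x /=.
  by apply: (fmorph_inj (nu ji)); rewrite autKV /= !autKV.
have VL s : V s -> fixes iota s by case=> /UL.
have nu_cover s : fixes iota s -> exists ji, V (autM (autV (nu ji)) s).
  move=> Ls; have [j Uj] := mu_cover s Ls.
  have: autZ s a \in rts by apply: stable; apply: rtP.
  case/(nthP 0)=> i; rewrite sz_rts => lti Di; exists (j, Ordinal lti).
  split; first exact/nuU.
  by apply/Va; rewrite autZM -Di -[rts`_i]/(rt (Ordinal lti)) -(nu_a (j, _)) autZVK.
have nu_inj ji ji' : V (autM (autV (nu ji)) (nu ji')) -> ji = ji'.
  case=> Ujj /Va; rewrite autZM nu_a => e.
  have {e} e2 : ji.2 = ji'.2.
    by apply: rt_inj; rewrite -(nu_a ji) -e autZKV.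
  have e1 : ji.1 = ji'.1.
    apply: mu_inj; move/nuU: Ujj => Ujj.
    apply: (os_ext oU) (osM oU Ujj (osV oU (Utt ji'))) => x /=.
    by rewrite autKV.
  by rewrite (surjective_pairing ji) e1 e2 -surjective_pairing.
have [f [irr_f sz_f cl_f]] := realise_cluster oV VL nuL nu_cover nu_inj.
have nuJ ji v : autZ (autM (autV (nu ji)) (autM v (nu ji))) a
    = autZ (autV (nu ji)) (autZ v (rt ji.2)) by rewrite autZM autZM nu_a.
exists f; split=> //.
  by rewrite sz_f card_prod !card_ord mulnC.
move=> alpha /cl_f; set good := [set _ | _].
suff -> : #|good| = r by [].
(* A root fixed by [V] must be [a], whereas the component in the quotient by [U] is free because [U]
   is normal. *)
have -> : good = setX setT [set i0].
  apply/setP=> ji; rewrite !inE /=; apply/asboolP/eqP => [good_ji|ji0 v [Uv va]].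
    apply: rt_inj; apply: unique => // s /thetaP Us sa.
    have [|_ /Va] := good_ji s; first by split=> //; apply/Va.
    by rewrite nuJ => /(congr1 (autZ (nu ji))); rewrite autZKV nu_a.
  split; first exact: normU.
  have nu_fix : autZ (nu ji) a = a by rewrite nu_a ji0.
  by apply/Va; rewrite nuJ ji0 -/a (Va v).1 // -{1}nu_fix autZVK.
by rewrite cardsX cardsT cards1 card_ord muln1.
Qed.

(** The kernel [U] is normal in the index-two subgroup [F], so the cosets inside [F] are fixed by
    [U]; failure of normality in the whole group excludes the others. *)
Lemma cluster_exists_index2 (L : fieldExtType rat) (iota : {rmorphism L -> algC}) (r' : nat) :
  exists f : {poly L},
    [/\ irreducible_poly f, size f = (2 * r'.+2).+1 &
        forall alpha : algC, root (map_poly iota f) alpha ->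
          cluster_size iota f alpha r'.+2].
Proof.
set r := r'.+2; have oL := fixes_open iota.
have [theta thetaP] := stab_Zbar oL.
have [rts [Urts sz_rts stable trans _]] := generic_roots theta (ltn0Sn 1).
case: rts sz_rts => [|d1 [|d2 []]] // _ in Urts stable trans *.
have ne_d : d2 != d1 by move: Urts; rewrite /= inE andbT eq_sym.
pose F s := fixes iota s /\ stab [:: val d1] s.
have Fd s : stab [:: val d1] s <-> autZ s d1 = d1.
  by rewrite stab1P -val_autZ; split=> [/val_inj|->].
have oF : open_subgroup F := open_subgroupI oL (stab_open _).
have FL s : F s -> fixes iota s by case.
have fix_d2 s : autZ s d1 = d1 -> autZ s d2 = d2.
  move=> s_d1; have := stable s d2; rewrite !inE eqxx orbT => /(_ isT).
  by rewrite -{1}s_d1 (inj_eq (@autZ_inj s)) (negPf ne_d) => /eqP.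
have normF s t : fixes iota s -> F t -> F (autJ s t).
  move=> Ls [Lt /Fd t_d1]; split.
    by apply: (osM oL) => //; apply: (osM oL) => //; apply: (osV oL).
  apply/Fd; rewrite autZJ; have := stable (autV s) d1; rewrite !inE eqxx => /(_ isT).
  have t_d2 := fix_d2 _ t_d1.
  by case/orP=> /eqP e; rewrite e ?t_d1 ?t_d2 -{1}e autZKV.
have [psi [sigma [psiM oU Fs Us moved]]] := kummer_exists r' oL oF FL normF.
pose U s := F s /\ psi s = 0.
have UL s : U s -> fixes iota s by case=> /FL.
have onto := character_onto oF psiM oU Fs Us.
have quot s t : F s -> F t -> U (autM (autV s) t) <-> psi s = psi t.
  by move=> Fs' Ft; apply: (character_quotient oF psiM oU).
pose mu (j : 'Z_r) := projT1 (cid2 (onto j)).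
have [Fmu Dmu] : (forall j, F (mu j)) /\ forall j, psi (mu j) = j.
  by split=> j; rewrite /mu; case: cid2.
have [tau /thetaP Ltau tau_d1] : exists2 s : aut, autZ s theta = theta & autZ s d1 = d2.
  by apply: trans; rewrite !inE eqxx ?orbT.
have nFtau : ~ F tau by case=> _ /Fd; rewrite tau_d1 => /eqP; rewrite (negPf ne_d).
pose nu (bj : bool * 'Z_r) : aut := if bj.1 then autM tau (mu bj.2) else mu bj.2.
have nuL bj : fixes iota (nu bj).
  by case: bj => -[] j; [apply: (osM oL) => //|]; apply/FL/Fmu.
have nu_d1 bj : autZ (nu bj) d1 = if bj.1 then d2 else d1.
  by case: bj => -[] j; rewrite /nu /= ?autZM ((Fd _).1 (Fmu j).2).
have nu_cover s : fixes iota s -> exists bj, U (autM (autV (nu bj)) s).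
  move=> Ls; have := stable s d1; rewrite !inE eqxx => /(_ isT)/orP[]/eqP s_d1.
    have Fs1 : F s by split=> //; apply/Fd.
    by exists (false, psi s); exact: ((quot _ _ (Fmu _) Fs1).2 (Dmu _)).
  have Fts : F (autM (autV tau) s).
    split; first by apply: (osM oL) => //; apply: (osV oL).
    by apply/Fd; rewrite autZM s_d1 -tau_d1 autZVK.
  exists (true, psi (autM (autV tau) s)).
  apply: (os_ext oU) ((quot _ _ (Fmu _) Fts).2 (Dmu _)) => x /=.
  apply: (fmorph_inj (nu (true, psi (autM (autV tau) s)))).
  by rewrite [RHS]autKV /= !autKV.
have nu_inj bj cj : U (autM (autV (nu bj)) (nu cj)) -> bj = cj.
  move=> Ubc; have: autZ (nu cj) d1 = autZ (nu bj) d1.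
    have [[_ /Fd]] := Ubc; rewrite autZM => /(congr1 (autZ (nu bj))).
    by rewrite autZKV.
  have mu_inj i j : U (autM (autV (mu i)) (mu j)) -> i = j by move/quot; rewrite !Dmu; apply.
  rewrite !nu_d1; case: bj cj Ubc => -[] i [[] j] /= Uij /eqP.
  - move=> _; congr (_, _); apply: mu_inj.
    apply: (os_ext oU) Uij => x; apply: (fmorph_inj (nu (true, i))).
    by rewrite [LHS]autKV /= autKV.
  - by rewrite eq_sym (negPf ne_d).
  - by rewrite (negPf ne_d).
  by move=> _; congr (_, _); apply: mu_inj.
have [f [irr_f sz_f cl_f]] := realise_cluster oU UL nuL nu_cover nu_inj.
exists f; split=> //.
  by rewrite sz_f card_prod card_bool card_ord.
move=> alpha /cl_f; set good := [set _ | _].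
suff -> : #|good| = r by [].
have -> : good = setX [set false] setT.
  apply/setP=> -[b j]; rewrite !inE /= andbT; apply/asboolP/eqP => [good_bj|-> v Uv].
    case: b good_bj => // good_bj; set w := nu (true, j) in good_bj.
    have nFw : ~ F w by case=> _ /Fd; rewrite nu_d1 => /eqP; rewrite (negPf ne_d).
    have Fw : F (autJ w sigma) by apply: normF => //; apply: nuL.
    (* Fixing the coset of [w] would conjugate this element of [U] back to [sigma], on which [psi]
       is a unit. *)
    have /good_bj Uw : U (autJ w sigma) by split=> //; apply: moved => //; apply: nuL.
    have [_ psi0] : U sigma.
      by apply: (os_ext oU) Uw => x; rewrite /= !autVK.
    by rewrite psi0 unitr0 in Us.
  exact: (character_kernel_normal oF psiM oU (Fmu j) Uv).
by rewrite cardsX cardsT cards1 card_ord mul1n.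
Qed.

Theorem theorem3p1 (L : fieldExtType rat) (iota : {rmorphism L -> algC})
    (n r : nat) :
  (2 < n)%N -> (0 < r)%N -> (r %| n)%N ->
  exists f : {poly L},
    [/\ irreducible_poly f, size f = n.+1 &
        forall alpha : algC, root (map_poly iota f) alpha -> cluster_size iota f alpha r].
Proof.
move=> n_gt2 r_gt0 /dvdnP[m Dn]; rewrite {n}Dn in n_gt2 *.
have [m2|ne_m2] := eqVneq m 2; last first.
  by apply: cluster_exists_index_neq2 => //; case: (m) n_gt2.
(* Here [n] is twice [r], so [n] above 2 forces [r] to be at least 2. *)
rewrite m2 in n_gt2 *; case: r => [|[|r']] // in n_gt2 r_gt0 *.
exact: cluster_exists_index2.
Qed.
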